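(* Let $W\in\tilde{\mathcal W}_q(\mathbf G^* )$. Then for subsets $S\subseteq\mathbf G\setminus\{0\}$ we have $$\delta_S=\left(\inf\{\|A-G\|_\sim^2 : A\in\mathbf M_q',\ G\in\mathcal M(S^0)^d\}\right)^{-1}.$$
   Context: $\mathbf G$ is a discrete abelian group with neutral element $0$, $\mathbf G^*$ its compact dual group, $\lambda$ the Haar measure on $\mathbf G^*$ with $\lambda(\mathbf G^* )=1$. Integrals are over $\mathbf G^*$. For $q\in\mathbb N=\{1,2,\dots\}$, $\mathbf M_q$ is the algebra of complex $q\times q$ matrices (matrices are also viewed as constant functions), $\mathbf M_q'$ the set of those with determinant $1$, and $\mathrm{tr}$ the normalized trace ($\mathrm{tr}\,I=1$). $\mathcal W_q(\mathbf G^* )$ is the set of integrable functions on $\mathbf G^*$ with values in the positive (definite) Hermitian $q\times q$ matrices; $\tilde{\mathcal W}_q(\mathbf G^* )$ is the set of $W\in\mathcal W_q(\mathbf G^* )$ with $W^{-1}$ integrable. $L^2(W)$ is the left Hilbert $\mathbf M_q$-module of (classes of) measurable $F:\mathbf G^*\to\mathbf M_q$ with $\mathrm{tr}(FWF^* )$ integrable, with $\mathbf M_q$-valued inner product $(F,G)=\int FWG^*\,d\lambda$ and norm $\|F\|=(\mathrm{tr}(F,F))^{1/2}$. For $L^2(W^{-1})$ the corresponding objects are $(F,G)_\sim=\int FW^{-1}G^*\,d\lambda$ and $\|F\|_\sim=(\mathrm{tr}(F,F)_\sim)^{1/2}$. For $S\subseteq\mathbf G$, $\mathcal T(S)$ is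 the left $\mathbf M_q$-module of all $\mathbf M_q$-valued trigonometric polynomials with frequencies in $S$ (finite sums $\sum_{g\in S}A_g\chi_g$, $A_g\in\mathbf M_q$, $\chi_g$ the character of $\mathbf G^*$ defined by $g$; $\mathcal T(\emptyset)=\{0\}$), $\mathcal M(S)$ is its closure in $L^2(W)$, and $S^0=S\cup\{0\}$. For $S\subseteq\mathbf G\setminus\{0\}$, $$\delta_S=\inf\{\|A-F\|^2: A\in\mathbf M_q',\ F\in\mathcal M(S)\}.$$ For a submodule $\mathcal M$ of $L^2(W)$, its dual is $\mathcal M^d=\{G\in L^2(W^{-1}):\int FG^*\,d\lambda=0\text{ for all }F\in\mathcal M\}$. *)

(* Defs.v *)
From HB Require Import structures.
From mathcomp Require Import all_boot all_order all_algebra.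
From mathcomp Require Import sesquilinear spectral.
From mathcomp Require Import complex.
From mathcomp Require Import all_classical all_reals all_analysis.
Import Order.TTheory GRing.Theory Num.Theory.
Import numFieldNormedType.Exports.

Set Implicit Arguments.
Unset Strict Implicit.
Unset Printing Implicit Defensive.

Local Open Scope classical_set_scope.
Local Open Scope sesquilinear_scope.
Local Open Scope ring_scope.

(* The dual group of a discrete abelian group: every homomorphism into the
   unit circle is continuous. *)
Record dual_group (R : realType) (G : zmodType) := DualGroup {
  dual_fun :> G -> R[i] ;
  dual_funD : forall g h, dual_fun (g + h) = dual_fun g * dual_fun h ;
  dual_fun_norm1 : forall g, `|dual_fun g| = 1 }.

Section dual_group_structure.
Context (R : realType) (G : zmodType).
Local Notation dual := (dual_group R G).

HB.instance Definition _ := gen_eqMixin dual.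
HB.instance Definition _ := gen_choiceMixin dual.

Lemma dual_group_ext (x y : dual) : x =1 y -> x = y.
Proof.
case: x y => [f fD f1] [f' f'D f'1] /= /funext ff'.
by subst f'; congr DualGroup; exact: Prop_irrelevance.
Qed.

Fact dual_one_D (g h : G) : 1 = 1 * 1 :> R[i].
Proof. by rewrite mulr1. Qed.

Fact dual_one_norm1 (g : G) : `|1 : R[i]| = 1.
Proof. exact: normr1. Qed.

Definition dual_one : dual := DualGroup dual_one_D dual_one_norm1.

Section operations.
Variables x y : dual.

Fact dual_mul_D g h : x (g + h) * y (g + h) = x g * y g * (x h * y h).
Proof. by rewrite !dual_funD mulrACA. Qed.

Fact dual_mul_norm1 g : `|x g * y g| = 1.
Proof. by rewrite normrM !dual_fun_norm1 mulr1. Qed.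

Definition dual_mul : dual := DualGroup dual_mul_D dual_mul_norm1.

Fact dual_inv_D g h : (x (g + h))^-1 = (x g)^-1 * (x h)^-1.
Proof. by rewrite dual_funD invfM. Qed.

Fact dual_inv_norm1 g : `|(x g)^-1| = 1.
Proof. by rewrite normfV dual_fun_norm1 invr1. Qed.

Definition dual_inv : dual := DualGroup dual_inv_D dual_inv_norm1.

End operations.

Fact dual_fun_neq0 (x : dual) g : x g != 0.
Proof. by rewrite -normr_eq0 dual_fun_norm1 oner_neq0. Qed.

Fact dual_mulA : associative dual_mul.
Proof. by move=> x y z; apply: dual_group_ext => g /=; rewrite mulrA. Qed.

Fact dual_mul1 : left_id dual_one dual_mul.
Proof. by move=> x; apply: dual_group_ext => g /=; rewrite mul1r. Qed.

Fact dual_mulr1 : right_id dual_one dual_mul.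
Proof. by move=> x; apply: dual_group_ext => g /=; rewrite mulr1. Qed.

Fact dual_mulV : left_inverse dual_one dual_inv dual_mul.
Proof.
by move=> x; apply: dual_group_ext => g /=; rewrite mulVf ?dual_fun_neq0.
Qed.

Fact dual_mulrV : right_inverse dual_one dual_inv dual_mul.
Proof.
by move=> x; apply: dual_group_ext => g /=; rewrite mulfV ?dual_fun_neq0.
Qed.

HB.instance Definition _ := isGroup.Build dual
  dual_mulA dual_mul1 dual_mulr1 dual_mulV dual_mulrV.

HB.instance Definition _ := isPointed.Build dual dual_one.

(* G being discrete, the compact-open topology is that of pointwise
   convergence. *)
HB.instance Definition _ := Topological.copy dual
  (initial_topology (@dual_fun R G : dual -> {ptws G -> (R[i])^o})).

End dual_group_structure.

Notation dual_borel R G := (g_sigma_algebraType (@open (dual_group R G))).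

Definition haar_measure (R : realType) (G : zmodType)
    (lambda : probability (dual_borel R G) R) : Prop :=
  [/\ forall (x : dual_group R G) (A : set (dual_borel R G)), measurable A ->
        lambda ((fun y : dual_group R G => (x * y)%g) @^-1` A) = lambda A,
      forall A : set (dual_borel R G), measurable A ->
        lambda A = ereal_inf
          [set lambda U | U in [set U : set (dual_group R G) |
                                 open U /\ A `<=` U]]
    & forall U : set (dual_group R G), open U ->
        lambda U = ereal_sup
          [set lambda K | K in [set K : set (dual_group R G) |
                                 compact K /\ K `<=` U]]].

Section matrix_functions.
Context d (T : measurableType d) (R : realType) (mu : {measure set T -> \bar R}).
Context (q : nat).
Local Notation C := (R[i]).
Implicit Types (f : T -> C) (F G W : T -> 'M[C]_q).

Definition cmeasurable f : Prop :=
  measurable_fun setT (fun x => complex.Re (f x)) /\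
  measurable_fun setT (fun x => complex.Im (f x)).

Definition cintegrable f : Prop :=
  mu.-integrable setT (fun x => (complex.Re (f x))%:E) /\
  mu.-integrable setT (fun x => (complex.Im (f x))%:E).

Definition cintegral f : C :=
  Complex (\int[mu]_x complex.Re (f x)) (\int[mu]_x complex.Im (f x)).

Definition mxmeasurable F : Prop :=
  forall i j, cmeasurable (fun x => F x i j).

Definition mxintegrable F : Prop :=
  forall i j, cintegrable (fun x => F x i j).

Definition mxintegral F : 'M[C]_q :=
  \matrix_(i, j) cintegral (fun x => F x i j).

Definition ntr (A : 'M[C]_q) : C := \tr A / q%:R.

Definition posdefmx (A : 'M[C]_q) : Prop :=
  A \is hermsymmx /\
  forall v : 'rV[C]_q, v != 0 -> 0 < (v *m A *m v^t*) 0 0.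

Definition inv_weight W : T -> 'M[C]_q := fun x => invmx (W x).

Definition weight W : Prop := (forall x, posdefmx (W x)) /\ mxintegrable W.

Definition invertible_weight W : Prop :=
  weight W /\ mxintegrable (inv_weight W).

(* Functions rather than classes: all the sets of functions below are
   saturated under almost everywhere equality, except [trig_poly], of which
   only the closure is used. *)
Definition L2 W : set (T -> 'M[C]_q) :=
  [set F | mxmeasurable F /\
           cintegrable (fun x => ntr (F x *m W x *m (F x)^t*))].

Definition inner W F G : 'M[C]_q :=
  mxintegral (fun x => F x *m W x *m (G x)^t*).

(* [ntr (inner W F F)] is real and nonnegative for a weight [W] and [F] in
   [L2 W]. *)
Definition L2norm W F : R := Num.sqrt (complex.Re (ntr (inner W F F))).

Definition L2closure W (M : set (T -> 'M[C]_q)) : set (T -> 'M[C]_q) :=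
  [set F | L2 W F /\
    forall e : R, 0 < e -> exists2 P, M P & L2norm W (F \- P) < e].

Definition L2dual W (M : set (T -> 'M[C]_q)) : set (T -> 'M[C]_q) :=
  [set G | L2 (inv_weight W) G /\
    forall F, M F -> mxintegral (fun x => F x *m (G x)^t*) = 0].

(* inf of ||A - F||^2 over constant A with det A = 1 and F in M; taken in
   [\bar R], where the inverse of 0 is +oo. *)
Definition inf_unimodular W (M : set (T -> 'M[C]_q)) : \bar R :=
  ereal_inf [set ((L2norm W (cst AF.1 \- AF.2)) ^+ 2)%:E |
    AF in [set AF : 'M[C]_q * (T -> 'M[C]_q) | \det AF.1 = 1 /\ M AF.2]].

End matrix_functions.

Section prediction.
Context (R : realType) (G : zmodType) (q : nat).
Local Notation T := (dual_borel R G).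
Variable lambda : probability (dual_borel R G) R.
Implicit Types (S : set G) (W : T -> 'M[R[i]]_q).

Definition trig_poly S : set (T -> 'M[R[i]]_q) :=
  [set F | exists (s : seq G) (A : G -> 'M[R[i]]_q),
    (forall g, g \in s -> S g) /\
    F = (fun x : dual_group R G => \sum_(g <- s) x g *: A g)].

Definition trig_closure W S : set (T -> 'M[R[i]]_q) :=
  L2closure lambda W (trig_poly S).

Definition delta W S : \bar R := inf_unimodular lambda W (trig_closure W S).

End prediction.

(* Main.v *)
Require Import Defs.
From HB Require Import structures.
From mathcomp Require Import all_boot all_order all_algebra.
From mathcomp Require Import sesquilinear spectral.
From mathcomp Require Import complex.
From mathcomp Require Import all_classical all_reals all_analysis.
From mathcomp Require Import measurable_realfun.
From mathcomp Require Import ring lra.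
Import Order.TTheory GRing.Theory Num.Theory.
Import numFieldNormedType.Exports.

(** Let [X] be the difference of the constant [1] and its orthogonal projection
    on the closure of the polynomials with frequencies in [S], and let [D] be
    the Gram matrix [(X, X)] in [L2 W] ([projection_exists]). A constant [A]
    differs from its projection by [A X], whose squared norm is the normalized
    trace of [A D A^*]; by the inequality between the trace and the determinant
    ([trace_AGM]) the infimum over unimodular [A] is the number [c] for which
    some unimodular [A] gives [A D A^* = c 1] ([posdef_unimodular_congr],
    [sqnorm_ge_unimodular]).

    For the other side, [G |-> G W^-1] is an isometry from [L2 (W^-1)] onto
    [L2 W] that carries the integral pairing to the inner product, so the dual
    of the closed span of [S] and [0] becomes an orthogonal complement, and a
    constant [B] becomes [B W^-1]. The point is that [W^-1] represents
    integration, [(F, W^-1) = int F]. A nontrivial character of the dual group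
    has integral [0] ([haar_char_integral]), hence [W^-1] is orthogonal to
    every polynomial with frequencies in [S], while [(X, W^-1) = int X = 1].
    Therefore [W^-1] projects on [D^-1 X] in the closed span of [S] and [0],
    and the Gram matrix of that projection is [D^-1]. The extremal value for
    [D^-1] is the inverse of the one for [D] ([unimodular_duality]).

    Two facts carry the analysis. [L2 W] is complete ([L2_complete]): as [W^-1]
    is integrable, the norm of [L2 W] dominates that of [L1], so a rapidly
    Cauchy sequence converges almost everywhere, and Fatou's lemma identifies
    the limit. And the characters of the dual group separate the elements of
    the group ([dual_group_separates]): the circle is divisible, so Zorn's lemma
    extends characters from subgroups. *)

Set Implicit Arguments.
Unset Strict Implicit.
Unset Printing Implicit Defensive.

Local Open Scope classical_set_scope.
Local Open Scope sesquilinear_scope.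
Local Open Scope ring_scope.

(** * Positive definite matrices *)

Section adjoint.
Context {R : realType}.
Local Notation C := R[i].

Lemma adjmxM m n p (A : 'M[C]_(m, n)) (B : 'M[C]_(n, p)) :
  (A *m B)^t* = B^t* *m A^t*.
Proof. by rewrite trmx_mul map_mxM. Qed.

Lemma adjmxD m n (A B : 'M[C]_(m, n)) : (A + B)^t* = A^t* + B^t*.
Proof. by rewrite linearD /= map_mxD. Qed.

Lemma adjmxB m n (A B : 'M[C]_(m, n)) : (A - B)^t* = A^t* - B^t*.
Proof. by rewrite linearB /= map_mxB. Qed.

Lemma adjmxZ m n a (A : 'M[C]_(m, n)) : (a *: A)^t* = Num.conj a *: A^t*.
Proof. by rewrite linearZ /= map_mxZ. Qed.

Lemma adjmx1 n : (1%:M : 'M[C]_n)^t* = 1%:M.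
Proof. by rewrite trmx1 map_mx1. Qed.

Lemma adjmx0 m n : (0 : 'M[C]_(m, n))^t* = 0.
Proof. by rewrite trmx0 map_mx0. Qed.

Lemma adjmxV n (A : 'M[C]_n) : (invmx A)^t* = invmx (A^t*).
Proof. by rewrite trmx_inv map_invmx. Qed.

Lemma det_adjmx n (A : 'M[C]_n) : \det (A^t*) = Num.conj (\det A).
Proof. by rewrite det_map_mx det_tr. Qed.

Lemma sandwichE m n p (F : 'M[C]_(m, n)) (W : 'M[C]_n) (G : 'M[C]_(p, n)) i j :
  (F *m W *m G^t*) i j = (row i F *m W *m (row j G)^t*) 0 0.
Proof.
rewrite -row_mul !mxE; apply: eq_bigr => k _; rewrite !mxE; congr (_ * _).
Qed.

Lemma hermsymmx_adj n (W : 'M[C]_n) : W \is hermsymmx -> W^t* = W.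
Proof. by move=> /is_hermitianmxP; rewrite expr0 scale1r => <-. Qed.

Lemma adj_hermsymmx n (W : 'M[C]_n) : W^t* = W -> W \is hermsymmx.
Proof. by move=> WE; apply/is_hermitianmxP; rewrite expr0 scale1r WE. Qed.

Lemma hermitian_diag n (A : 'M[C]_n) : A \is hermsymmx ->
  exists (P : 'M[C]_n) (d : 'rV[C]_n),
    P \is unitarymx /\ P *m A *m P^t* = diag_mx d.
Proof.
move=> /hermitian_normalmx/orthomx_spectralP AE.
exists (spectralmx A), (spectral_diag A).
have PU := spectral_unitarymx A; split=> //.
rewrite -invmx_unitary // [X in _ *m X *m _]AE !mulmxA mulmxV ?spectral_unit //.
by rewrite mul1mx mulmxK ?spectral_unit.
Qed.

(** The arithmetic-geometric mean inequality for the eigenvalues of [M M^*]. *)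
Lemma trace_AGM n (M : 'M[C]_n) : \det M = 1 -> n%:R <= \tr (M *m M^t*).
Proof.
case: n M => [|n] M detM; first by rewrite /mxtrace big_ord0.
have herm : M *m M^t* \is hermsymmx.
  by apply: adj_hermsymmx; rewrite adjmxM trmxCK.
have [P [d [PU Pd]]] := hermitian_diag herm.
have trE : \tr (M *m M^t*) = \sum_i d 0 i.
  rewrite -mxtrace_diag -Pd [RHS]mxtrace_mulC -(invmx_unitary PU).
  by rewrite mulKmx // unitarymx_unit.
have detE : \prod_i d 0 i = 1.
  rewrite -det_diag -Pd -(invmx_unitary PU) 2!det_mulmx mulrAC -det_mulmx.
  rewrite mulmxV ?unitarymx_unit // det1 mul1r det_mulmx det_adjmx detM.
  by rewrite rmorph1 mulr1.
have dge0 i : 0 <= d 0 i.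
  have -> : d 0 i = (diag_mx d) i i by rewrite mxE eqxx.
  rewrite -Pd mulmxA -[_ *m _ *m _]mulmxA -adjmxM.
  rewrite mxE; apply: sumr_ge0 => k _; rewrite ![_^t* _ _]mxE ![_^T _ _]mxE.
  exact: mul_conjC_ge0.
have dnneg : {in predT, forall i, 0 <= d 0 i *+ #|'I_n.+1|}.
  by move=> i _; rewrite mulrn_wge0.
have [+ _] := leif_AGM_scaled dnneg.
rewrite card_ord -trE => AGM; rewrite -(@ler_pXn2r _ n.+1) ?nnegrE ?ler0n //;
  last first.
  by rewrite trE sumr_ge0.
apply: le_trans AGM.
under [leRHS]eq_bigr do rewrite -mulr_natr.
by rewrite big_split /= detE mul1r prodr_const card_ord.
Qed.

End adjoint.

Section posdef.
Context {R : realType} {q : nat}.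
Local Notation C := R[i].
Implicit Types (W D : 'M[C]_q).

Lemma posdef_adj W : posdefmx W -> W^t* = W.
Proof. by case=> /hermsymmx_adj. Qed.

Lemma posdef_row_gt0 W m (F : 'M[C]_(m, q)) i :
  posdefmx W -> row i F != 0 -> 0 < (F *m W *m F^t*) i i.
Proof. by move=> [_ Wpos] Fi; rewrite sandwichE Wpos. Qed.

Lemma posdef_row_ge0 W m (F : 'M[C]_(m, q)) i :
  posdefmx W -> 0 <= (F *m W *m F^t*) i i.
Proof.
move=> Wpos; have [Fi0|Fi] := eqVneq (row i F) 0.
  by rewrite sandwichE Fi0 !mul0mx mxE.
by rewrite ltW // posdef_row_gt0.
Qed.

Lemma posdef_unit W : posdefmx W -> W \in unitmx.
Proof.
move=> Wpos; rewrite unitmxE unitfE; apply/det0P => -[v v0 vW].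
have [_ /(_ v v0)] := Wpos.
by rewrite vW mul0mx mxE ltxx.
Qed.

Lemma posdef_inv W : posdefmx W -> posdefmx (invmx W).
Proof.
move=> Wpos; have WU := posdef_unit Wpos; split.
  by apply: adj_hermsymmx; rewrite adjmxV posdef_adj.
move=> v v0.
have -> : v *m invmx W *m v^t* =
          (v *m invmx W) *m W *m (v *m invmx W)^t*.
  by rewrite adjmxM adjmxV posdef_adj // mulmxKV // !mulmxA.
have [_] := Wpos; apply.
by apply: contraNneq v0 => vW; rewrite -(mulmxKV WU v) vW mul0mx.
Qed.

(** A positive definite [D] is congruent, by a matrix of determinant one, to a
    scalar matrix: rescale the eigenvectors by the square roots of the
    eigenvalues, then divide by a [q]-th root of the determinant so obtained. *)
Lemma posdef_unimodular_congr D : (0 < q)%N -> posdefmx D ->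
  exists (A : 'M[C]_q) (c : R),
    [/\ \det A = 1, 0 < c & A *m D *m A^t* = (c%:C%C)%:M].
Proof.
move=> q0 Dpos; have [Dherm _] := Dpos.
have [P [d [PU Pd]]] := hermitian_diag Dherm.
have Punit := unitarymx_unit PU.
have dgt0 i : 0 < d 0 i.
  have -> : d 0 i = (diag_mx d) i i by rewrite mxE eqxx.
  rewrite -Pd posdef_row_gt0 //; apply: contraTneq Punit => Pi0.
  rewrite unitmxE unitfE negbK; apply/eqP.
  rewrite (expand_det_row P i) big1 // => j _.
  by move/rowP: Pi0 => /(_ j); rewrite !mxE => ->; rewrite mul0r.
pose s : 'rV[C]_q := \row_i (sqrtC (d 0 i))^-1.
pose K := diag_mx s *m P.
have KD : K *m D *m K^t* = 1%:M.
  have -> : K *m D *m K^t* = diag_mx s *m (P *m D *m P^t*) *m (diag_mx s)^t*.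
    by rewrite /K adjmxM !mulmxA.
  rewrite Pd tr_diag_mx map_diag_mx !mulmx_diag.
  apply/matrixP => i j; rewrite !mxE; case: eqP => //= _;
    rewrite ?mulr0n // !mulr1n.
  have sd0 : sqrtC (d 0 i) != 0 by rewrite sqrtC_eq0 gt_eqF.
  have sdge0 : 0 <= sqrtC (d 0 i) by rewrite sqrtC_ge0 ltW.
  rewrite (CrealP _) ?realV ?ger0_real //.
  by rewrite -[X in _ * X / _]sqrtCK expr2 mulKf // divff.
have detK : \det K != 0.
  apply/eqP => detK; have /(congr1 determinant) := KD.
  by rewrite 2!det_mulmx detK !mul0r det1 => /eqP; rewrite eq_sym oner_eq0.
have [z zE] : exists z : C, z ^+ q = \det K.
  by exists (q.-root (\det K)); rewrite rootCK.
have z0 : z != 0 by apply: contraNneq detK => z0; rewrite -zE z0 expr0n gtn_eqF.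
exists (z^-1 *: K), (complex.Re (`|z| ^- 2)); split.
- by rewrite detZ -zE exprVn mulVf // expf_neq0.
- have : 0 < `|z| ^- 2 by rewrite invr_gt0 exprn_gt0 // normr_gt0.
  by rewrite ltcE => /andP[].
- rewrite adjmxZ -!scalemxAl -scalemxAr KD !scale_scalar_mx mulr1 RRe_real.
    by rewrite -normCK normfV exprVn.
  by rewrite ger0_real // invr_ge0 exprn_ge0.
Qed.

(** Expand [(f - c g) W (f - c g)^* >= 0] at the [c] of modulus [t^-1] with the
    phase of [f W g^*]. *)
Lemma sandwich_CS W m n (F : 'M[C]_(m, q)) (G : 'M[C]_(n, q)) i j (t : C) :
  posdefmx W -> 0 < t ->
  `|(F *m W *m G^t*) i j| <=
    t * (F *m W *m F^t*) i i + t^-1 * (G *m W *m G^t*) j j.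
Proof.
move=> Wpos t0; have WE := posdef_adj Wpos.
rewrite (sandwichE F _ G) (sandwichE F) (sandwichE G).
move: (row i F) (row j G) => {}f {}g; set b := (_ *m g^t*) 0 0.
set a := (f *m W *m f^t*) 0 0; set e := (g *m W *m g^t*) 0 0.
have a0 : 0 <= a by exact: posdef_row_ge0.
have e0 : 0 <= e by exact: posdef_row_ge0.
have [->|bn0] := eqVneq b 0.
  by rewrite normr0 addr_ge0 // mulr_ge0 // ?invr_ge0 ltW.
have bconj : (g *m W *m f^t*) 0 0 = Num.conj b.
  rewrite /b -[in LHS]WE -{1}(trmxCK g) -!adjmxM mulmxA.
  by rewrite [LHS]mxE mxE.
pose c := b / (`|b| * t).
have expand (A B B' E : 'M[C]_1) :
  (A - c *: B' - (Num.conj c *: B - Num.conj c *: (c *: E))) 0 0 =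
  A 0 0 - c * B' 0 0 - Num.conj c * B 0 0 + c * Num.conj c * E 0 0.
  by rewrite !mxE; ring.
have := posdef_row_ge0 (f - c *: g) 0 Wpos.
rewrite adjmxB adjmxZ mulmxBl mulmxBr !mulmxBl -!scalemxAr -!scalemxAl.
rewrite expand bconj -/a -/b -/e.
have nb0 : `|b| != 0 by rewrite normr_eq0.
have tn0 : t != 0 by rewrite gt_eqF.
have tC : Num.conj t = t by apply/CrealP; rewrite gtr0_real.
have cC : Num.conj c = Num.conj b / (`|b| * t).
  rewrite /c rmorphM fmorphV rmorphM /= tC; congr (_ / (_ * _)).
  by apply/CrealP; exact: normr_real.
have bb : b * Num.conj b = `|b| ^+ 2 by rewrite normCK.
have -> : c * Num.conj b = `|b| / t.
  by rewrite /c mulrAC bb; field; rewrite tn0 nb0.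
have -> : Num.conj c * b = `|b| / t.
  by rewrite cC mulrAC [_ * b]mulrC bb; field; rewrite tn0 nb0.
have -> : c * Num.conj c = t^-1 ^+ 2.
  by rewrite cC /c mulrACA bb; field; rewrite tn0 nb0.
move=> /(mulr_ge0 (ltW t0)).
have -> : t * (a - `|b| / t - `|b| / t + t^-1 ^+ 2 * e) =
          t * a + t^-1 * e - `|b| - `|b| by field.
rewrite subr_ge0 lerBrDr => h; apply: le_trans h.
by rewrite lerDl normr_ge0.
Qed.

End posdef.

(** * Characters separate the points of the group *)

Section characters.
Context {R : realType} {G : zmodType}.
Local Notation C := R[i].
Implicit Types (f : set (G * C)) (h : G) (w : C).

(** A homomorphism from a subgroup of [G] to the circle, encoded by its graph:
    the union of a chain of extensions is then its upper bound. *)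
Record partial_char f : Prop := PartialChar {
  pchar_unit : f (0, 1);
  pchar_sub : forall a b z w, f (a, z) -> f (b, w) -> f (a - b, z / w);
  pchar_norm : forall a z, f (a, z) -> `|z| = 1;
  pchar_ker : forall z, f (0, z) -> z = 1 }.

Definition pchar_extend f h w : set (G * C) :=
  [set p | exists a z (k : int),
    f (a, z) /\ p = (a + h *~ k, z * w ^ k)].

Section theory.
Variables (f : set (G * C)) (fP : partial_char f).

Lemma pchar_neq0 a z : f (a, z) -> z != 0.
Proof. by move=> /(pchar_norm fP) z1; rewrite -normr_eq0 z1 oner_eq0. Qed.

Lemma pchar_opp a z : f (a, z) -> f (- a, z^-1).
Proof.
move=> faz; have := pchar_sub fP (pchar_unit fP) faz.
by rewrite sub0r mul1r.
Qed.

Lemma pchar_add a b z w : f (a, z) -> f (b, w) -> f (a + b, z * w).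
Proof.
move=> faz /pchar_opp fbw; have := pchar_sub fP faz fbw.
by rewrite opprK invrK.
Qed.

Lemma pchar_muln a z n : f (a, z) -> f (a *+ n, z ^+ n).
Proof.
move=> faz; elim: n => [|n IHn]; first exact: (pchar_unit fP).
by rewrite mulrS exprS; exact: pchar_add.
Qed.

Lemma pchar_fun a z w : f (a, z) -> f (a, w) -> z = w.
Proof.
move=> faz faw; have := pchar_sub fP faz faw; rewrite subrr => /(pchar_ker fP).
move=> /(canRL (mulfVK (pchar_neq0 faw))); by rewrite mul1r.
Qed.

Lemma pchar_extendP h w : `|w| = 1 ->
  (forall n z, f (h *+ n, z) -> z = w ^+ n) ->
  partial_char (pchar_extend f h w).
Proof.
move=> w1 wf; have w0 : w != 0 by rewrite -normr_eq0 w1 oner_eq0.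
split.
- by exists 0, 1, 0; split; [exact: pchar_unit|rewrite mulr0z addr0 mulr1].
- move=> _ _ _ _ [a [z [k [faz [-> ->]]]]] [b [y [l [fby [-> ->]]]]].
  exists (a - b), (z / y), (k - l); split; first exact: pchar_sub.
  rewrite mulrzBr opprD addrACA; congr pair.
  by rewrite expfzDr // -invr_expz invfM mulrACA.
- move=> _ _ [a [z [k [faz [_ ->]]]]].
  rewrite normrM (pchar_norm fP faz) mul1r.
  by case: k => n; rewrite ?NegzE /exprz ?normfV normrX w1 expr1n ?invr1.
- move=> _ [a [z [k [faz [/esym/eqP ahk ->]]]]].
  have z0 := pchar_neq0 faz.
  case: k ahk => n; rewrite ?NegzE.
    rewrite addrC addr_eq0 => /eqP hn.
    have /wf zw : f (h *+ n, z^-1) by rewrite pmulrn hn; exact: pchar_opp.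
    by rewrite -exprnP -zw divff.
  rewrite mulrNz subr_eq0 => /eqP aE; rewrite aE in faz.
  by rewrite (wf _ _ faz) -exprnN mulfV // expf_neq0.
Qed.

Lemma pchar_extend_sub h w : f `<=` pchar_extend f h w.
Proof.
by move=> [a z] faz; exists a, z, 0; rewrite mulr0z addr0 mulr1.
Qed.

Lemma pchar_extend_mem h w : pchar_extend f h w (h, w).
Proof.
exists 0, 1, 1; split; first exact: (pchar_unit fP).
by rewrite mulr1z add0r mul1r expr1z.
Qed.

(** The circle is divisible: if some positive multiple of [h] lies in the
    domain of [f], a root of the value at the least such multiple will do. *)
Lemma pchar_extendable h :
  exists2 w, `|w| = 1 & forall n z, f (h *+ n, z) -> z = w ^+ n.
Proof.
have [[m mP]|nex] := pselect
  (exists m, (0 < m)%N && `[<exists z, f (h *+ m, z)>]).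
  have exm : exists m, (0 < m)%N && `[<exists z, f (h *+ m, z)>] by exists m.
  case: (ex_minnP exm) => d /andP[d0 /asboolP[y fy]] dmin.
  have yE : (d.-root y) ^+ d = y by rewrite rootCK.
  exists (d.-root y).
    apply/eqP; rewrite -(@pexpr_eq1 _ _ d) ?normr_ge0 // -normrX yE.
    by rewrite (pchar_norm fP fy).
  move=> n z; rewrite {1 2}(divn_eq n d) => fz.
  have fr : f (h *+ (n %% d), z / y ^+ (n %/ d)).
    have := pchar_sub fP fz (pchar_muln (n %/ d) fy).
    by rewrite -mulrnA mulnC mulrnDr addrC addKr.
  have r0 : (n %% d = 0)%N.
    apply/eqP; rewrite -leqn0 leqNgt; apply/negP => rgt0.
    have /dmin : (0 < n %% d)%N && `[<exists z, f (h *+ (n %% d), z)>].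
      by rewrite rgt0; apply/asboolP; exists (z / y ^+ (n %/ d)).
    by rewrite leqNgt ltn_mod d0.
  rewrite r0 addn0 mulnC exprM yE.
  move: fr; rewrite r0 mulr0n => /(pchar_ker fP).
  move=> /(canRL (mulfVK _)); rewrite mul1r; apply.
  by rewrite expf_neq0 // (pchar_neq0 fy).
exists 1; first by rewrite normr1.
move=> n z fz; case: n fz => [|n fz]; first by rewrite expr0;
  exact: (pchar_ker fP).
case: nex; exists n.+1; apply/andP; split=> //; apply/asboolP; by exists z.
Qed.

End theory.

(** A root of [1 + X + ... + X^(n-1)]; in characteristic zero [1] is not one. *)
Lemma root_of_unity_neq1 n : (1 < n)%N -> exists2 w : C, w != 1 & w ^+ n = 1.
Proof.
case: n => // n n1.
have /closed_rootP[w] : size (\sum_(i < n.+1) 'X^i : {poly C}) != 1%N.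
  have -> : \sum_(i < n.+1) 'X^i = \poly_(i < n.+1) 1 :> {poly C}.
    by rewrite poly_def; apply: eq_bigr => i _; rewrite scale1r.
  by rewrite size_poly_eq ?oner_neq0 // gtn_eqF.
rewrite /root horner_sum => /eqP sum0; exists w.
  apply: contra_eq_neq sum0 => ->.
  under eq_bigr do rewrite hornerXn expr1n.
  by rewrite sumr_const card_ord pnatr_eq0.
apply/eqP; rewrite -subr_eq0 subrX1.
under eq_bigr do rewrite -hornerXn.
by rewrite sum0 mulr0.
Qed.

(** Before anything else [g] is sent to some [w] different from [1]: a root of
    unity whose order divides that of [g], or [-1] if [g] has infinite order. *)
Lemma pchar_init g : g != 0 ->
  exists f w, [/\ partial_char f, f (g, w) & w != 1].
Proof.
move=> g0.
pose f0 : set (G * C) := [set (0, 1)].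
have f0P : partial_char f0.
  split=> //.
  - by move=> a b z w [-> ->] [-> ->]; rewrite subr0 divr1.
  - by move=> a z [_ ->]; rewrite normr1.
  - by move=> z [].
suff [w [w1 wn1 wf]] : exists w : C, [/\ `|w| = 1, w != 1 &
    forall n, g *+ n = 0 -> w ^+ n = 1].
  exists (pchar_extend f0 g w), w; split=> //.
    by apply: pchar_extendP => // n z [/wf -> ->].
  exact: pchar_extend_mem.
have [exm|nex] := pselect (exists m, (0 < m)%N && (g *+ m == 0)).
  case: (ex_minnP exm) => d /andP[d0 /eqP gd] dmin.
  have d1 : (1 < d)%N.
    by case: d d0 gd {dmin} => [|[|d]] // _; rewrite mulr1n => /eqP;
      rewrite (negPf g0).
  have [w wn1 wd] := root_of_unity_neq1 d1; exists w; split=> //.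
    by apply/eqP; rewrite -(@pexpr_eq1 _ _ d) ?normr_ge0 // -normrX wd normr1.
  move=> n; rewrite (divn_eq n d) mulrnDr mulnC mulrnA gd mul0rn add0r => gr.
  rewrite exprD exprM wd expr1n mul1r.
  suff -> : (n %% d = 0)%N by [].
  apply/eqP; rewrite -leqn0 leqNgt; apply/negP => rgt0.
  have /dmin : (0 < n %% d)%N && (g *+ (n %% d) == 0) by rewrite rgt0 gr eqxx.
  by rewrite leqNgt ltn_mod d0.
exists (-1); split; first by rewrite normrN1.
  by rewrite eq_sym -subr_eq0 opprK -mulr2n pnatr_eq0.
case=> [|n] gn; first by rewrite expr0.
by case: nex; exists n.+1; rewrite gn eqxx.
Qed.

(** Zorn's lemma: a maximal partial character is defined everywhere. *)
Lemma dual_group_separates g : g != 0 -> exists x : dual_group R G, x g != 1.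
Proof.
move=> /pchar_init[f1 [w [f1P f1g wn1]]].
(* The predicate bears on the union with [f1], so that the empty chain has an
   upper bound and the maximal element extends [f1]. *)
have [F FP Fchain|f [fP fmax]] :=
    @Zorn_bigcup _ [set f | partial_char (f `|` f1)].
  pose U := \bigcup_(X in F) X.
  have dir p1 p2 : (U `|` f1) p1 -> (U `|` f1) p2 ->
      exists X, [/\ partial_char (X `|` f1), X `<=` U, (X `|` f1) p1 &
        (X `|` f1) p2].
    have XU X : F X -> X `<=` U by move=> FX p Xp; exists X.
    move=> [[X FX Xp1]|f1p1] [[Y FY Yp2]|f1p2].
    - have [XY|YX] := Fchain _ _ FX FY.
        by exists Y; split; [exact: FP|exact: XU|left; exact: XY|left].
      by exists X; split; [exact: FP|exact: XU|left|left; exact: YX].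
    - by exists X; split; [exact: FP|exact: XU|left|right].
    - by exists Y; split; [exact: FP|exact: XU|right|left].
    - by exists set0; split; rewrite ?set0U //; exact: sub0set.
  split.
  - right; exact: (pchar_unit f1P).
  - move=> a b z y p1 p2; have [X [XP XU /(pchar_sub XP) h /h]] :=
      dir _ _ p1 p2.
    by move=> [/XU|]; [left|right].
  - move=> a z p1; have [X [XP _ /(pchar_norm XP)]] := dir _ _ p1 p1; by [].
  - by move=> z p1; have [X [XP _ /(pchar_ker XP)]] := dir _ _ p1 p1.
have total h : exists z, (f `|` f1) (h, z).
  have [z z1 zf] := pchar_extendable fP h.
  have eP := pchar_extendP fP z1 zf.
  have sub := @pchar_extend_sub _ h z.
  exists z; apply: contrapT => nfz.
  apply: (fmax (pchar_extend (f `|` f1) h z)).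
    split=> [p fp|]; first by apply: sub; left.
    by move=> /(_ _ (pchar_extend_mem fP h z)) fhz; apply: nfz; left.
  by rewrite /= setUidl // => p f1p; apply: sub; right.
have [x xP] := choice total.
have xD a b : x (a + b) = x a * x b.
  by apply: (pchar_fun fP (xP _)); exact: pchar_add.
have x1 a : `|x a| = 1 by exact: (pchar_norm fP (xP a)).
exists (DualGroup xD x1) => /=.
suff -> : x g = w by [].
by apply: (pchar_fun fP (xP g)); right.
Qed.

End characters.

(** * Integration of complex functions *)

Section complex_integration.
Context d (T : measurableType d) (R : realType)
  (mu : {measure set T -> \bar R}).
Local Notation C := R[i].
Local Notation Re := (@complex.Re R).
Local Notation Im := (@complex.Im R).
Implicit Types (f g : T -> C) (c : C).

Lemma Re_conjC (z : C) : Re (Num.conj z) = Re z. Proof. by case: z. Qed.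
Lemma Im_conjC (z : C) : Im (Num.conj z) = - Im z. Proof. by case: z. Qed.
Lemma Re_add (z w : C) : Re (z + w) = Re z + Re w. Proof. by case: z;
  case: w. Qed.
Lemma Im_add (z w : C) : Im (z + w) = Im z + Im w. Proof. by case: z;
  case: w. Qed.
Lemma Re_mul (z w : C) : Re (z * w) = Re z * Re w - Im z * Im w.
Proof. by case: z; case: w. Qed.
Lemma Im_mul (z w : C) : Im (z * w) = Re z * Im w + Im z * Re w.
Proof. by case: z; case: w. Qed.
Lemma complex_ext (z w : C) : Re z = Re w -> Im z = Im w -> z = w.
Proof. by case: z => ? ?; case: w => ? ? /= -> ->. Qed.

Lemma Re_le_norm (z : C) (a : R) : `|z| <= a%:C%C -> `|Re z| <= a.
Proof. by move=> za; rewrite -lecR; apply: le_trans za; exact: normc_ge_Re. Qed.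

Lemma Im_le_norm (z : C) (a : R) : `|z| <= a%:C%C -> `|Im z| <= a.
Proof.
move=> za; have := @Re_le_norm (z * 'i%C) a.
rewrite ReiNIm normrN; apply.
rewrite normrM [X in _ * X](_ : _ = 1) ?mulr1 //.
by rewrite normc_def /= expr0n add0r expr1n sqrtr1.
Qed.

Lemma norm_le_ReIm (z : C) : `|z| <= (`|Re z| + `|Im z|)%:C%C.
Proof.
rewrite {1}(complexE z); apply: le_trans (ler_normD _ _) _.
rewrite rmorphD /= normrM; apply: lerD.
  by rewrite normc_def /= expr0n addr0 sqrtr_sqr.
by rewrite !normc_def /= expr0n /= add0r expr1n sqrtr1 mul1r addr0 sqrtr_sqr.
Qed.

Lemma cmeasurable_cst c : cmeasurable (fun _ : T => c).
Proof. by split; exact: measurable_cst. Qed.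

Lemma cmeasurableD f g :
  cmeasurable f -> cmeasurable g -> cmeasurable (fun x => f x + g x).
Proof.
move=> [f1 f2] [g1 g2]; split.
  by under eq_fun do rewrite Re_add; exact: measurable_funD.
by under eq_fun do rewrite Im_add; exact: measurable_funD.
Qed.

Lemma cmeasurableM f g :
  cmeasurable f -> cmeasurable g -> cmeasurable (fun x => f x * g x).
Proof.
move=> [f1 f2] [g1 g2]; split.
  by under eq_fun do rewrite Re_mul; apply: measurable_funB;
    exact: measurable_funM.
by under eq_fun do rewrite Im_mul; apply: measurable_funD;
  exact: measurable_funM.
Qed.

Lemma cmeasurable_conj f :
  cmeasurable f -> cmeasurable (fun x => Num.conj (f x)).
Proof.
move=> [f1 f2]; split; first by under eq_fun do rewrite Re_conjC.
by under eq_fun do rewrite Im_conjC; exact: measurableT_comp.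
Qed.

Lemma cmeasurable_sum (I : Type) (s : seq I) (P : pred I) (F : I -> T -> C) :
  (forall i, cmeasurable (F i)) ->
    cmeasurable (fun x => \sum_(i <- s | P i) F i x).
Proof.
move=> mF; elim: s => [|i s IHs].
  by under eq_fun do rewrite big_nil; exact: cmeasurable_cst.
under eq_fun do rewrite big_cons; case: (P i) => //.
exact: cmeasurableD.
Qed.

Lemma cintegrable_cmeasurable f : cintegrable mu f -> cmeasurable f.
Proof.
by move=> [/measurable_int/measurable_EFinP ? /measurable_int/measurable_EFinP
  ?].
Qed.

Lemma integrable_le_real (f g : T -> R) :
  measurable_fun setT f -> mu.-integrable setT (EFin \o g) ->
  (forall x, `|f x| <= g x) -> mu.-integrable setT (EFin \o f).
Proof.
move=> mf ig fg; apply: (le_integrable measurableT _ _ ig).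
  exact/measurable_EFinP.
move=> x _ /=; rewrite lee_fin; apply: le_trans (fg x) _; exact: ler_norm.
Qed.

Lemma cintegrable_dominated f (g : T -> R) :
  cmeasurable f -> mu.-integrable setT (EFin \o g) ->
  (forall x, `|f x| <= (g x)%:C%C) -> cintegrable mu f.
Proof.
move=> [f1 f2] ig fg; split.
  by apply: (integrable_le_real f1 ig) => x; exact: Re_le_norm.
by apply: (integrable_le_real f2 ig) => x; exact: Im_le_norm.
Qed.

Lemma cintegrableD f g : cintegrable mu f -> cintegrable mu g ->
  cintegrable mu (fun x => f x + g x).
Proof.
move=> [f1 f2] [g1 g2]; split.
  under eq_fun do rewrite Re_add EFinD.
  exact: (integrableD measurableT f1 g1).
under eq_fun do rewrite Im_add EFinD.
exact: (integrableD measurableT f2 g2).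
Qed.

Lemma integrableZ_real (a : R) (h : T -> R) :
  mu.-integrable setT (EFin \o h) ->
  mu.-integrable setT (EFin \o (fun x => a * h x)).
Proof. exact: (integrableZl measurableT). Qed.

Lemma integrableD_real (f g : T -> R) :
  mu.-integrable setT (EFin \o f) -> mu.-integrable setT (EFin \o g) ->
  mu.-integrable setT (EFin \o (fun x => f x + g x)).
Proof. exact: (integrableD measurableT). Qed.

Lemma cintegrableZ c f : cintegrable mu f -> cintegrable mu (fun x => c * f x).
Proof.
move=> [f1 f2]; split.
  under eq_fun do rewrite Re_mul EFinB.
  by apply: (integrableB measurableT); exact: integrableZ_real.
under eq_fun do rewrite Im_mul EFinD.
by apply: (integrableD measurableT); exact: integrableZ_real.
Qed.

Lemma cintegrable_conj f : cintegrable mu f ->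
  cintegrable mu (fun x => Num.conj (f x)).
Proof.
move=> [f1 f2]; split; first by under eq_fun do rewrite Re_conjC.
under eq_fun do rewrite Im_conjC EFinN.
exact: (integrableN f2).
Qed.

Lemma cintegralD f g : cintegrable mu f -> cintegrable mu g ->
  cintegral mu (fun x => f x + g x) = cintegral mu f + cintegral mu g.
Proof.
move=> [f1 f2] [g1 g2]; apply: complex_ext => /=.
  under eq_Rintegral do rewrite Re_add.
  by rewrite RintegralD.
under eq_Rintegral do rewrite Im_add.
by rewrite RintegralD.
Qed.

Lemma cintegralZ c f : cintegrable mu f ->
  cintegral mu (fun x => c * f x) = c * cintegral mu f.
Proof.
move=> [f1 f2]; apply: complex_ext; rewrite ?Re_mul ?Im_mul /=.
  under eq_Rintegral do rewrite Re_mul.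
  rewrite RintegralB //; try exact: integrableZ_real.
  by rewrite !RintegralZl.
under eq_Rintegral do rewrite Im_mul.
rewrite RintegralD //; try exact: integrableZ_real.
by rewrite !RintegralZl.
Qed.

Lemma cintegral_conj f : cintegrable mu f ->
  cintegral mu (fun x => Num.conj (f x)) = Num.conj (cintegral mu f).
Proof.
move=> [f1 f2]; apply: complex_ext; rewrite ?Re_conjC ?Im_conjC /=.
  by under eq_Rintegral do rewrite Re_conjC.
under eq_Rintegral do rewrite Im_conjC -mulN1r.
by rewrite RintegralZl // mulN1r.
Qed.

Lemma cintegral0 : cintegral mu (fun=> 0) = 0.
Proof. by apply: complex_ext => /=; rewrite Rintegral_cst //= mul0r. Qed.

Lemma cintegrable0 : cintegrable mu (fun=> 0).
Proof. by split; exact: integrable0. Qed.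

Lemma cintegrable_sum (I : Type) (s : seq I) (F : I -> T -> C) :
  (forall i, cintegrable mu (F i)) ->
  cintegrable mu (fun x => \sum_(i <- s) F i x).
Proof.
move=> iF; elim: s => [|i s IHs].
  by under eq_fun do rewrite big_nil; exact: cintegrable0.
under eq_fun do rewrite big_cons; exact: cintegrableD.
Qed.

Lemma cintegral_sum (I : Type) (s : seq I) (F : I -> T -> C) :
  (forall i, cintegrable mu (F i)) ->
  cintegral mu (fun x => \sum_(i <- s) F i x) =
    \sum_(i <- s) cintegral mu (F i).
Proof.
move=> iF; elim: s => [|i s IHs].
  by under eq_fun do rewrite big_nil; rewrite big_nil cintegral0.
rewrite big_cons -IHs -cintegralD //; last exact: cintegrable_sum.
by under eq_fun do rewrite big_cons.
Qed.

(** The factor [2] pays for bounding real and imaginary parts separately. *)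
Lemma cintegral_norm_le f (g : T -> R) :
  cmeasurable f -> mu.-integrable setT (EFin \o g) ->
  (forall x, `|f x| <= (g x)%:C%C) ->
  `|cintegral mu f| <= (2 * \int[mu]_x g x)%:C%C.
Proof.
move=> mf ig fg; have [f1 f2] := cintegrable_dominated mf ig fg.
apply: le_trans (norm_le_ReIm _) _; rewrite lecR mulr2n mulrDl mul1r /=.
apply: lerD; apply: le_trans (le_normr_Rintegral _ _) _ => //;
  apply: le_Rintegral => //; try exact: integrable_norm.
- by move=> x _; exact: Re_le_norm.
- by move=> x _; exact: Im_le_norm.
Qed.

End complex_integration.

(** * Nontrivial characters have mean zero *)

Lemma ptws_cvgP {U : Type} {V : topologicalType} (F : set_system (U -> V))
    (f : U -> V) : Filter F ->
  {ptws, F --> f} <-> forall t : U, g t @[g --> F] --> f t.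
Proof.
move=> FF; rewrite cvg_sup; split=> + t => /(_ t).
  rewrite cvg_image; last by rewrite eqEsubset; split=> v // _; exists (cst v).
  apply: cvg_trans => A /=; rewrite ?nbhs_simpl /fmap /= => [[B FB <-]].
  by apply: filterS FB => g Bg /=; exists g.
rewrite cvg_image; last by rewrite eqEsubset; split=> v // _; exists (cst v).
move=> + A //=; rewrite ?nbhs_simpl => tF => /tF FA;
  exists (@^~ t @^-1` A) => //.
by rewrite eqEsubset; split => [v [? + <-//]|v Av]; exists (fun _ => v).
Qed.

Section haar.
Context {R : realType} {G : zmodType}.
Local Notation C := R[i].
Local Notation dual := (dual_group R G).
Local Notation Re := (@complex.Re R).
Local Notation Im := (@complex.Im R).

Lemma dual_eval_continuous g : continuous (fun x : dual => x g : C^o).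
Proof.
move=> x.
have cx : (@dual_fun R G : dual -> {ptws G -> C^o}) @ x -->
  (x : {ptws G -> C^o}).
  exact: initial_continuous.
have FF : Filter (@dual_fun R G @ x) :=
  @fmap_filter _ _ _ (nbhs x) (nbhs_filter x).
have h := iffLR (@ptws_cvgP G C^o (@dual_fun R G @ x) x FF) cx g.
by move=> A /h.
Qed.

Lemma dual_mul_continuous (y : dual) : continuous (fun x : dual => (y * x)%g).
Proof.
apply: continuous_comp_initial => x.
pose h := @dual_fun R G \o (fun x : dual => (y * x)%g).
have FF : Filter (h @ x) := @fmap_filter _ _ _ (nbhs x) (nbhs_filter x).
apply: (iffRL (@ptws_cvgP G C^o (h @ x) (h x) FF)) => g.
have : (fun z : dual => (y g : C^o) * (z g : C^o)) @ x -->
  (y g : C^o) * (x g : C^o).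
  by apply: (@cvgMl_tmp _ _ (nbhs x) (nbhs_filter x));
    exact: dual_eval_continuous.
by [].
Qed.

Lemma dual_translation_measurable (y : dual) :
  measurable_fun setT ((fun x => (y * x)%g) : dual_borel R G -> dual_borel R G).
Proof.
apply: (@measurability _ _ (dual_borel R G) (dual_borel R G) setT _
  (@open dual)).
  by [].
move=> _ [U oU <-].
rewrite setTI; apply: sub_sigma_algebra.
by move/continuousP: (@dual_mul_continuous y); apply.
Qed.

Lemma Re_open_gt (a : R) : open [set z : C^o | a < Re z].
Proof.
rewrite openE => z /= az; apply/nbhs_ballP.
exists ((Re z - a)%:C)%C; first by rewrite /= ltcR subr_gt0.
move=> w; rewrite /ball /= => zw.
have h := le_lt_trans (normc_ge_Re (z - w)) zw.
rewrite ltcR in h; have := le_lt_trans (ler_norm _) h.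
have -> : Re (z - w) = Re z - Re w by case: (z); case: (w).
by rewrite ltrD2l ltrN2.
Qed.

Lemma char_cmeasurable g : cmeasurable (fun x : dual_borel R G => (x : dual) g).
Proof.
have Re_meas (h : dual -> C^o) : continuous h ->
    measurable_fun setT ((fun x => Re (h x)) : dual_borel R G -> R).
  move=> hc; apply: (measurability _ (RGenOInfty.measurableE R)) => //.
  move=> _ [_ [a ->] <-]; rewrite setTI; apply: sub_sigma_algebra.
  rewrite (_ : _ @^-1` _ = h @^-1` [set z | a < Re z]); last first.
    by apply/seteqP; split => x /=; rewrite in_itv /= andbT.
  by move/continuousP: hc; apply; exact: Re_open_gt.
split; first by apply: Re_meas; exact: dual_eval_continuous.
(* The imaginary part of [z] is the real part of [- i z]. *)
have mi : measurable_fun setT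
    ((fun x => Re (- 'i%C * (x : dual) g)) : dual_borel R G -> R).
  by apply: Re_meas => x; apply: (@cvgMl_tmp _ _ (nbhs x) (nbhs_filter x));
    exact: dual_eval_continuous.
rewrite (_ : (fun x : dual_borel R G => Im _) = (fun x : dual_borel R G =>
  Re (- 'i%C * (x : dual) g))) //.
apply/funext => x; rewrite mulNr mulrC.
by case: ((x : dual) g) => a b /=; rewrite mulr0 mulr1 add0r opprK.
Qed.

(** A nontrivial character [g] takes a value other than [1] at some [y], and
    translation by [y] multiplies its integral by that value. *)
Lemma haar_char_integral (lambda : probability (dual_borel R G) R) g :
  haar_measure lambda -> g != 0 ->
  cintegrable lambda (fun x : dual_borel R G => (x : dual) g) /\
  cintegral lambda (fun x : dual_borel R G => (x : dual) g) = 0.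
Proof.
move=> [inv _ _] g0.
have ch : cintegrable lambda (fun x : dual_borel R G => (x : dual) g).
  apply: (cintegrable_dominated (char_cmeasurable g) (g := fun=> 1)).
    exact: finite_measure_integrable_cst.
  by move=> x; rewrite dual_fun_norm1.
split=> //.
have [y yg] := dual_group_separates (R := R) g0.
have my := dual_translation_measurable y.
pose phi : dual_borel R G -> dual_borel R G := fun x => (y * x)%g.
have shift (f : dual_borel R G -> R) : measurable_fun setT f ->
    lambda.-integrable setT (EFin \o f \o phi) ->
    \int[lambda]_x f (phi x) = \int[lambda]_x f x.
  move=> mf fi; rewrite /Rintegral; congr fine.
  have pf := @integral_pushforward _ _ _ _ R phi my lambda setT (EFin \o f)
    (iffRL (measurable_EFinP _ _) mf) fi measurableT.
  rewrite preimage_setT in pf;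
    transitivity (\int[lambda]_x (EFin \o f \o phi) x)%E => //.
  rewrite -pf.
  apply: (eq_measure_integral lambda) => A mA _; exact: inv.
have [mRe mIm] := cintegrable_cmeasurable ch.
have [iRe iIm] := cintegrableZ (y g) ch.
have eqI : cintegral lambda (fun x : dual_borel R G => y g * (x : dual) g) =
           cintegral lambda (fun x : dual_borel R G => (x : dual) g).
  by apply: complex_ext; [exact: (shift _ mRe)|exact: (shift _ mIm)].
move: eqI; rewrite cintegralZ // => /eqP.
rewrite -subr_eq0 -{2}[cintegral _ _]mul1r -mulrBl mulf_eq0 subr_eq0.
by rewrite (negPf yg) => /eqP.
Qed.

End haar.

(** * The weighted space of matrix functions *)

Section matrix_integration.
Context d (T : measurableType d) (R : realType)
  (mu : {measure set T -> \bar R}).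
Context (q : nat).
Local Notation C := R[i].
Implicit Types (F G : T -> 'M[C]_q) (A : 'M[C]_q).

Lemma mxmeasurableM F G : mxmeasurable F -> mxmeasurable G ->
  mxmeasurable (fun x => F x *m G x).
Proof.
move=> mF mG i j; under eq_fun do rewrite mxE.
by apply: cmeasurable_sum => k; apply: cmeasurableM.
Qed.

Lemma mxmeasurable_adj F : mxmeasurable F -> mxmeasurable (fun x => (F x)^t*).
Proof.
move=> mF i j; under eq_fun do rewrite !mxE.
exact: cmeasurable_conj.
Qed.

Lemma mxmeasurableD F G : mxmeasurable F -> mxmeasurable G ->
  mxmeasurable (fun x => F x + G x).
Proof.
by move=> mF mG i j; under eq_fun do rewrite mxE; exact: cmeasurableD.
Qed.

Lemma mxmeasurable_cst A : mxmeasurable (fun _ : T => A).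
Proof. by move=> i j; exact: cmeasurable_cst. Qed.

Lemma mxintegrable_mxmeasurable F : mxintegrable mu F -> mxmeasurable F.
Proof. by move=> iF i j; apply: cintegrable_cmeasurable (iF i j). Qed.

Lemma mxintegrableD F G : mxintegrable mu F -> mxintegrable mu G ->
  mxintegrable mu (fun x => F x + G x).
Proof.
by move=> iF iG i j; under eq_fun do rewrite mxE; exact: cintegrableD.
Qed.

Lemma mxintegrable_mull A F : mxintegrable mu F ->
  mxintegrable mu (fun x => A *m F x).
Proof.
move=> iF i j; under eq_fun do rewrite mxE.
by apply: cintegrable_sum => k; exact: cintegrableZ.
Qed.

Lemma mxintegrable_adj F : mxintegrable mu F ->
  mxintegrable mu (fun x => (F x)^t*).
Proof.
by move=> iF i j; under eq_fun do rewrite !mxE; exact: cintegrable_conj.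
Qed.

Lemma mxintegralD F G : mxintegrable mu F -> mxintegrable mu G ->
  mxintegral mu (fun x => F x + G x) = mxintegral mu F + mxintegral mu G.
Proof.
move=> iF iG; apply/matrixP => i j; rewrite !mxE -cintegralD //.
by under eq_fun do rewrite mxE.
Qed.

Lemma mxintegral_mull A F : mxintegrable mu F ->
  mxintegral mu (fun x => A *m F x) = A *m mxintegral mu F.
Proof.
move=> iF; apply/matrixP => i j; rewrite !mxE.
under eq_fun do rewrite mxE.
rewrite cintegral_sum; last by move=> k; exact: cintegrableZ.
by apply: eq_bigr => k _; rewrite cintegralZ // mxE.
Qed.

Lemma mxintegral_adj F : mxintegrable mu F ->
  mxintegral mu (fun x => (F x)^t*) = (mxintegral mu F)^t*.
Proof.
move=> iF; apply/matrixP => i j; rewrite !mxE -cintegral_conj //.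
by under eq_fun do rewrite !mxE.
Qed.

Lemma mxintegrable_mulr A F : mxintegrable mu F ->
  mxintegrable mu (fun x => F x *m A).
Proof.
move=> iF; under eq_fun do rewrite -[_ *m A]trmxCK adjmxM.
by apply/mxintegrable_adj/mxintegrable_mull/mxintegrable_adj.
Qed.

Lemma ntrE A : ntr A = q%:R^-1 * \sum_i A i i.
Proof. by rewrite /ntr mulrC. Qed.

Lemma cintegrable_ntr F : mxintegrable mu F ->
  cintegrable mu (fun x => ntr (F x)).
Proof.
move=> iF; under eq_fun do rewrite ntrE.
by apply: cintegrableZ; apply: cintegrable_sum.
Qed.

Lemma cintegral_ntr F : mxintegrable mu F ->
  cintegral mu (fun x => ntr (F x)) = ntr (mxintegral mu F).
Proof.
move=> iF; under eq_fun do rewrite ntrE.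
rewrite cintegralZ; last exact: cintegrable_sum.
rewrite cintegral_sum // ntrE; congr (_ * _).
by apply: eq_bigr => i _; rewrite mxE.
Qed.

End matrix_integration.

Section weighted_L2.
Context d (T : measurableType d) (R : realType)
  (mu : {measure set T -> \bar R}).
Context (q : nat) (q0 : (0 < q)%N).
Local Notation C := R[i].
Local Notation Re := (@complex.Re R).
Local Notation Im := (@complex.Im R).
Variable W : T -> 'M[C]_q.
Hypothesis Wpos : forall x, posdefmx (W x).
Hypothesis Wmeas : mxmeasurable W.
Implicit Types (F G H : T -> 'M[C]_q) (A : 'M[C]_q).

Definition density F (x : T) : R := Re (ntr (F x *m W x *m (F x)^t*)).

Definition sqnorm F : R := Re (ntr (inner mu W F F)).

Lemma ntr_density F x : ntr (F x *m W x *m (F x)^t*) = (density F x)%:C%C.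
Proof.
rewrite /density RRe_real // ger0_real // /ntr divr_ge0 // sumr_ge0 // => i _.
exact: posdef_row_ge0.
Qed.

Lemma diag_le_density F x i :
  (F x *m W x *m (F x)^t*) i i <= (q%:R * density F x)%:C%C.
Proof.
rewrite rmorphM rmorph_nat /= -ntr_density /ntr mulrC divfK ?pnatr_eq0 -?lt0n
  //.
rewrite /mxtrace (bigD1 i) //= lerDl sumr_ge0 // => j _.
exact: posdef_row_ge0.
Qed.

Lemma density_ge0 F x : 0 <= density F x.
Proof.
rewrite -(@ler0c R) -ntr_density divr_ge0 // sumr_ge0 // => i _.
exact: posdef_row_ge0.
Qed.

(** The free parameter [t] replaces the Cauchy-Schwarz inequality: a large [t]
    makes the term in [G] negligible, uniformly in [F]. *)
Lemma sandwich_le_density (F G : T -> 'M[C]_q) x i j (t : R) : 0 < t ->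
  `|(F x *m W x *m (G x)^t*) i j| <=
    (t * (q%:R * density F x) + t^-1 * (q%:R * density G x))%:C%C.
Proof.
move=> t0; have tC : 0 < t%:C%C :> C by rewrite ltcR.
apply: le_trans (sandwich_CS _ _ i j (Wpos x) tC) _.
rewrite rmorphD (rmorphM _ t) (rmorphM _ t^-1) fmorphV /=; apply: lerD.
  by apply: ler_wpM2l; [exact: ltW|exact: diag_le_density].
by apply: ler_wpM2l; [rewrite invr_ge0 ltW|exact: diag_le_density].
Qed.

Lemma mxmeasurable_sandwich F G : mxmeasurable F -> mxmeasurable G ->
  mxmeasurable (fun x => F x *m W x *m (G x)^t*).
Proof.
by move=> mF mG; do !apply: mxmeasurableM => //; exact: mxmeasurable_adj.
Qed.

Lemma measurable_density F : mxmeasurable F -> measurable_fun setT (density F).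
Proof.
move=> mF.
suff [] : cmeasurable (fun x => ntr (F x *m W x *m (F x)^t*)) by [].
under eq_fun do rewrite ntrE.
apply: cmeasurableM; first exact: cmeasurable_cst.
by apply: cmeasurable_sum => i; exact: mxmeasurable_sandwich.
Qed.

Lemma L2P F : L2 mu W F <->
  mxmeasurable F /\ mu.-integrable setT (EFin \o density F).
Proof.
split=> -[mF]; first by case.
move=> iF; split=> //; split=> //.
by under eq_fun do rewrite ntr_density /=; exact: integrable0.
Qed.

Lemma L2_integrable F G : L2 mu W F -> L2 mu W G ->
  mxintegrable mu (fun x => F x *m W x *m (G x)^t*).
Proof.
move=> /L2P[mF iF] /L2P[mG iG] i j.
apply: (@cintegrable_dominated _ _ _ _ _
  (fun x => 1 * (q%:R * density F x) + 1^-1 * (q%:R * density G x))).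
- exact: mxmeasurable_sandwich.
- by apply: integrableD_real; do 2 apply: integrableZ_real.
- by move=> x; apply: sandwich_le_density.
Qed.

Lemma L2_of_sandwich F : mxmeasurable F ->
  mxintegrable mu (fun x => F x *m W x *m (F x)^t*) -> L2 mu W F.
Proof. by move=> mF iF; split=> //; exact: cintegrable_ntr. Qed.

Lemma L2D F G : L2 mu W F -> L2 mu W G -> L2 mu W (fun x => F x + G x).
Proof.
move=> LF LG; apply: L2_of_sandwich.
  by apply: mxmeasurableD; [case: LF|case: LG].
under eq_fun do rewrite adjmxD mulmxDr !mulmxDl.
by do !apply: mxintegrableD; exact: L2_integrable.
Qed.

Lemma L2_mull A F : L2 mu W F -> L2 mu W (fun x => A *m F x).
Proof.
move=> LF; apply: L2_of_sandwich.
  by apply: mxmeasurableM; [exact: mxmeasurable_cst|case: LF].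
have -> : (fun x => A *m F x *m W x *m (A *m F x)^t*) =
    (fun x => A *m (F x *m W x *m (F x)^t* *m A^t*)).
  by apply/funext => x; rewrite adjmxM !mulmxA.
by apply: mxintegrable_mull; apply: mxintegrable_mulr; exact: L2_integrable.
Qed.

Lemma L2N F : L2 mu W F -> L2 mu W (fun x => - F x).
Proof. by move=> /(L2_mull (- 1%:M));
  under eq_fun do rewrite mulNmx mul1mx. Qed.

Lemma L2B F G : L2 mu W F -> L2 mu W G -> L2 mu W (F \- G).
Proof. by move=> LF LG; exact: (L2D LF (L2N LG)). Qed.

Lemma innerDl F G H : L2 mu W F -> L2 mu W G -> L2 mu W H ->
  inner mu W (fun x => F x + G x) H = inner mu W F H + inner mu W G H.
Proof.
move=> LF LG LH; rewrite /inner; under eq_fun do rewrite !mulmxDl.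
by rewrite mxintegralD //; exact: L2_integrable.
Qed.

Lemma inner_mull A F H : L2 mu W F -> L2 mu W H ->
  inner mu W (fun x => A *m F x) H = A *m inner mu W F H.
Proof.
move=> LF LH; rewrite /inner -mxintegral_mull; last exact: L2_integrable.
by congr mxintegral; apply/funext => x; rewrite !mulmxA.
Qed.

Lemma inner_adj F G : L2 mu W F -> L2 mu W G ->
  (inner mu W F G)^t* = inner mu W G F.
Proof.
move=> LF LG; rewrite /inner -mxintegral_adj; last exact: L2_integrable.
by under eq_fun do rewrite !adjmxM trmxCK (posdef_adj (Wpos _)) mulmxA.
Qed.

Lemma sqnormE F : L2 mu W F -> sqnorm F = \int[mu]_x density F x.
Proof.
by move=> LF; rewrite /sqnorm -cintegral_ntr //; exact: L2_integrable.
Qed.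

Lemma ntr_sqnorm F : L2 mu W F -> ntr (inner mu W F F) = (sqnorm F)%:C%C.
Proof.
move=> LF; apply: complex_ext => //=.
rewrite -cintegral_ntr; last exact: L2_integrable.
rewrite /cintegral /=; under eq_Rintegral do rewrite ntr_density /=.
by rewrite Rintegral_cst // mul0r.
Qed.

Lemma sqnorm_ge0 F : L2 mu W F -> 0 <= sqnorm F.
Proof.
by move=> LF; rewrite sqnormE //; apply: Rintegral_ge0 => x _;
  exact: density_ge0.
Qed.

Lemma L2norm_sqr F : L2 mu W F -> L2norm mu W F ^+ 2 = sqnorm F.
Proof. by move=> LF; rewrite sqr_sqrtr //; exact: sqnorm_ge0. Qed.

Lemma inner_le_sqnorm F G i j (t : R) : L2 mu W F -> L2 mu W G -> 0 < t ->
  `|inner mu W F G i j| <=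
    (2 * (t * (q%:R * sqnorm F) + t^-1 * (q%:R * sqnorm G)))%:C%C.
Proof.
move=> LF LG t0; rewrite mxE.
have [mF iF] := iffLR (L2P F) LF; have [mG iG] := iffLR (L2P G) LG.
have iE (s : R) (H : T -> 'M[C]_q) : mu.-integrable setT (EFin \o density H) ->
    mu.-integrable setT (EFin \o (fun x => s * (q%:R * density H x))).
  by move=> iH; do 2 apply: integrableZ_real.
apply: le_trans (cintegral_norm_le _ _
  (fun x => sandwich_le_density F G x i j t0)) _.
- exact: mxmeasurable_sandwich.
- by apply: integrableD_real; exact: iE.
rewrite lecR ler_wpM2l // RintegralD //; try exact: iE.
have sE (s : R) (H : T -> 'M[C]_q) : L2 mu W H ->
    \int[mu]_x (s * (q%:R * density H x)) = s * (q%:R * sqnorm H).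
  move=> LH; have [_ iH] := iffLR (L2P H) LH.
  by rewrite RintegralZl ?RintegralZl ?sqnormE //; exact: integrableZ_real.
by rewrite !sE.
Qed.


Lemma innerNl F H : L2 mu W F -> L2 mu W H ->
  inner mu W (fun x => - F x) H = - inner mu W F H.
Proof.
move=> LF LH; have := inner_mull (- 1%:M) LF LH.
by under eq_fun do rewrite mulNmx mul1mx; rewrite mulNmx mul1mx.
Qed.

Lemma innerBl F G H : L2 mu W F -> L2 mu W G -> L2 mu W H ->
  inner mu W (F \- G) H = inner mu W F H - inner mu W G H.
Proof.
move=> LF LG LH; by rewrite -innerNl // -(innerDl LF (L2N LG)).
Qed.

Lemma innerBr F G H : L2 mu W F -> L2 mu W G -> L2 mu W H ->
  inner mu W H (F \- G) = inner mu W H F - inner mu W H G.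
Proof.
move=> LF LG LH; rewrite -(inner_adj (L2B LF LG) LH).
rewrite (innerBl LF LG LH) adjmxB.
by rewrite [X in X - _](inner_adj LF LH) [X in _ - X](inner_adj LG LH).
Qed.

Lemma inner_mulr A F H : L2 mu W F -> L2 mu W H ->
  inner mu W H (fun x => A *m F x) = inner mu W H F *m A^t*.
Proof.
move=> LF LH; rewrite -(inner_adj (L2_mull A LF) LH).
by rewrite (inner_mull A LF LH) adjmxM (inner_adj LF LH).
Qed.

End weighted_L2.

(** * Convergence of complex sequences and of series of functions *)

Section complex_convergence.
Context {R : realType}.
Local Notation C := R[i].
Local Notation Re := (@complex.Re R).
Local Notation Im := (@complex.Im R).
Implicit Types (u v : nat -> C) (l c : C).

(** Stated on real and imaginary parts, as measurability and integrability of
    complex functions are. *)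
Definition ccvg u l : Prop :=
  (Re (u n) @[n --> \oo] --> Re l) /\ (Im (u n) @[n --> \oo] --> Im l).

Lemma ccvg_cst c : ccvg (fun=> c) c.
Proof. by split; exact: cvg_cst. Qed.

Lemma ccvgD u v l m : ccvg u l -> ccvg v m -> ccvg (fun n => u n + v n) (l + m).
Proof.
move=> [u1 u2] [v1 v2]; split.
  by rewrite Re_add; under eq_fun do rewrite Re_add; exact: cvgD.
by rewrite Im_add; under eq_fun do rewrite Im_add; exact: cvgD.
Qed.

Lemma ccvgM u v l m : ccvg u l -> ccvg v m -> ccvg (fun n => u n * v n) (l * m).
Proof.
move=> [u1 u2] [v1 v2]; split.
  by rewrite Re_mul; under eq_fun do rewrite Re_mul; apply: cvgB; exact: cvgM.
by rewrite Im_mul; under eq_fun do rewrite Im_mul; apply: cvgD; exact: cvgM.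
Qed.

Lemma ccvg_conj u l : ccvg u l -> ccvg (fun n => Num.conj (u n)) (Num.conj l).
Proof.
move=> [u1 u2]; split.
  by rewrite Re_conjC; under eq_fun do rewrite Re_conjC.
by rewrite Im_conjC; under eq_fun do rewrite Im_conjC; exact: cvgN.
Qed.

Lemma ccvg_sum (I : Type) (s : seq I) (F : I -> nat -> C) (L : I -> C) :
  (forall i, ccvg (F i) (L i)) ->
  ccvg (fun n => \sum_(i <- s) F i n) (\sum_(i <- s) L i).
Proof.
move=> FL; elim: s => [|i s IHs].
  by rewrite big_nil; under eq_fun do rewrite big_nil; exact: ccvg_cst.
by rewrite big_cons; under eq_fun do rewrite big_cons; exact: ccvgD.
Qed.

Lemma ccvg_shift m u l : ccvg u l -> ccvg (fun n => u (n + m)%N) l.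
Proof.
move=> [u1 u2]; split; first by rewrite (cvg_shiftn m (fun n => Re (u n))).
by rewrite (cvg_shiftn m (fun n => Im (u n))).
Qed.

Lemma mxccvg_sandwich q (A W : 'M[C]_q) (B : nat -> 'M[C]_q) :
  (forall i j, ccvg (fun n => B n i j) (A i j)) ->
  ccvg (fun n => ntr (B n *m W *m (B n)^t*)) (ntr (A *m W *m A^t*)).
Proof.
move=> BA; rewrite /ntr mulrC; under eq_fun do rewrite mulrC.
apply: ccvgM; first exact: ccvg_cst.
apply: ccvg_sum => i; rewrite mxE; under eq_fun do rewrite mxE.
apply: ccvg_sum => k; apply: ccvgM; last first.
  rewrite 2!mxE; under eq_fun do rewrite 2!mxE.
  exact: ccvg_conj.
rewrite mxE; under eq_fun do rewrite mxE.
by apply: ccvg_sum => l; apply: ccvgM => //; exact: ccvg_cst.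
Qed.

End complex_convergence.

Section summable_functions.
Context d (T : measurableType d) (R : realType)
  (mu : {measure set T -> \bar R}).

(** The sum of the series has a finite integral, hence is finite off a null
    set. *)
Lemma summable_ae_cvg (phi : nat -> T -> R) (c : R) :
  0 <= c -> (forall n, measurable_fun setT (phi n)) ->
  (forall n x, 0 <= phi n x) ->
  (forall n, (\int[mu]_x (phi n x)%:E <= (c / (2 ^ n.+1)%:R)%:E)%E) ->
  exists N, [/\ measurable N, mu N = 0%E &
    forall x, ~ N x -> cvgn (series (phi^~ x))].
Proof.
move=> c0 mphi phi0 iphi.
have ephi0 n x : (0 <= (phi n x)%:E)%E by rewrite lee_fin.
pose Phi x := (\sum_(n <oo) (phi n x)%:E)%E.
have Phi0 x : (0 <= Phi x)%E by apply: nneseries_ge0 => n _ _; exact: ephi0.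
have mPhi : measurable_fun setT Phi.
  apply: (ge0_emeasurable_sum (h := fun n x => (phi n x)%:E)) => //.
  by move=> n _; exact/measurable_EFinP.
have PhiI : mu.-integrable setT Phi.
  apply/integrableP; split=> //.
  under eq_integral do rewrite gee0_abs //.
  rewrite integral_nneseries //; last by move=> n; exact/measurable_EFinP.
  apply: (@le_lt_trans _ _ c%:E); last exact: ltry.
  apply: le_trans (epsilon_trick0 xpredT c0).
  by apply: lee_nneseries => // n _ _; exact: integral_ge0.
have [N [mN muN sub]] := integrable_ae measurableT PhiI.
exists N; split=> // x Nx.
have Phifin : Phi x \is a fin_num by apply: contrapT => nfin; apply: Nx;
  apply: sub => /(_ I).
apply: nondecreasing_is_cvgn.
  by apply: nondecreasing_series => n _ _; exact: phi0.
exists (fine (Phi x)) => _ [n _ <-].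
rewrite -lee_fin fineK // /series /= -sumEFin.
exact: nneseries_lim_ge.
Qed.

Lemma cvg_increments (u phi : nat -> R) :
  (forall n, `|u n.+1 - u n| <= phi n) -> cvgn (series phi) -> cvgn u.
Proof.
move=> uphi cphi.
have : cvgn (series (telescope u)).
  apply: normed_cvg; apply: (series_le_cvg _ _ _ cphi) => //= n.
  exact: le_trans (normr_ge0 _) (uphi n).
rewrite telescopeK => cu.
have -> : u = (fun n => (u n - u 0%N) + u 0%N) by apply/funext => n;
  rewrite subrK.
by apply: is_cvgD => //; exact: is_cvg_cst.
Qed.

Lemma limn_einf_le (u : nat -> \bar R) (a : \bar R) :
  (forall n, (u n <= a)%E) -> (limn_einf u <= a)%E.
Proof.
move=> ua; rewrite limn_einf_lim (cvg_lim _ (@cvg_einfs_sup _ u)) //.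
apply: ub_ereal_sup => _ [n _ <-].
by apply: le_trans (ua n); apply: ereal_inf_lbound; exists n => /=.
Qed.

End summable_functions.

(** * Completeness of the weighted space *)

Section completeness.
Context d (T : measurableType d) (R : realType)
  (mu : {measure set T -> \bar R}).
Context (q : nat) (q0 : (0 < q)%N).
Local Notation C := R[i].
Local Notation Re := (@complex.Re R).
Local Notation Im := (@complex.Im R).
Variable W : T -> 'M[C]_q.
Hypothesis hW : invertible_weight mu W.
Implicit Types (F G H : T -> 'M[C]_q) (A : 'M[C]_q).

Let Wpos x : posdefmx (W x) := hW.1.1 x.
Let Wmeas : mxmeasurable W := mxintegrable_mxmeasurable hW.1.2.

Lemma cst_L2 A : L2 mu W (cst A).
Proof.
apply: L2_of_sandwich; first exact: mxmeasurable_cst.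
exact: (mxintegrable_mulr (A^t*) (mxintegrable_mull A hW.1.2)).
Qed.

Lemma inv_weight_adj x : (inv_weight W x)^t* = inv_weight W x.
Proof. by rewrite /inv_weight adjmxV (posdef_adj (Wpos x)). Qed.

Lemma mulmx_weightK F x : F x *m W x *m (inv_weight W x)^t* = F x.
Proof. by rewrite inv_weight_adj mulmxK // posdef_unit. Qed.

Lemma inv_weight_L2 : L2 mu W (inv_weight W).
Proof.
have [_ iV] := hW; apply: L2_of_sandwich.
  exact: mxintegrable_mxmeasurable iV.
by under eq_fun do rewrite mulmx_weightK.
Qed.

(** [inv_weight W] represents integration on [L2 W]; in particular the
    integral is continuous there. *)
Lemma inner_inv_weight F : inner mu W F (inv_weight W) = mxintegral mu F.
Proof. by rewrite /inner; under eq_fun do rewrite mulmx_weightK. Qed.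

(** As [inv_weight W] is itself in [L2 W] and represents the identity, the
    density controls the entries of a function, up to an integrable term. *)
Lemma entry_le_density F x i j (t : R) : 0 < t ->
  `|F x i j| <= (t * (q%:R * density W F x) +
                 t^-1 * (q%:R * density W (inv_weight W) x))%:C%C.
Proof. by move=> t0; rewrite -{1}(mulmx_weightK F);
  exact: sandwich_le_density. Qed.

(* A bound, up to powers of [2], for the integrals of the functions [phi n]
   below. *)
Let c := q%:R * (1 + sqnorm mu W (inv_weight W)) *+ 2.

Let c_ge0 : 0 <= c.
Proof.
rewrite /c mulrn_wge0 // mulr_ge0 // addr_ge0 //.
exact: (sqnorm_ge0 q0 Wpos Wmeas inv_weight_L2).
Qed.

(** Riesz-Fischer. The entries of the differences of a rapidly Cauchy sequence
    are dominated by functions with summable integrals, so the sequence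
    converges almost everywhere; Fatou's lemma bounds the distance of its terms
    to the limit. *)
Lemma L2_complete (P : nat -> T -> 'M[C]_q) :
  (forall n, L2 mu W (P n)) ->
  (forall n k, (n <= k)%N -> sqnorm mu W (P k \- P n) <= 4^-1 ^+ n) ->
  exists2 F, L2 mu W F & forall n, sqnorm mu W (F \- P n) <= 4^-1 ^+ n.
Proof.
move=> LP cauchy.
have LPB k n : L2 mu W (P k \- P n) := L2B q0 Wpos Wmeas (LP k) (LP n).
have densI F : L2 mu W F -> mu.-integrable setT (EFin \o density W F).
  by case/(L2P mu Wpos F).
(* The choice [t := 2 ^+ n] in [entry_le_density] makes both terms of order
   [2 ^- n] after integration: the first is at most [2 ^+ n * 4 ^- n]. *)
pose phi n x : R := 2 ^+ n * (q%:R * density W (P n.+1 \- P n) x) +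
   (2 ^+ n)^-1 * (q%:R * density W (inv_weight W) x).
have tn0 n : 0 < 2 ^+ n :> R by rewrite exprn_gt0.
have phiI n : mu.-integrable setT (EFin \o phi n).
  apply: integrableD_real; apply: integrableZ_real; apply: integrableZ_real.
    exact: densI.
  exact: (densI _ inv_weight_L2).
have mphi n : measurable_fun setT (phi n).
  exact/measurable_EFinP/(measurable_int mu (phiI n)).
have dge0 F x : 0 <= density W F x by exact: density_ge0.
have phi0 n x : 0 <= phi n x.
  have t0 := ltW (tn0 n).
  by apply: addr_ge0; apply: mulr_ge0; rewrite ?invr_ge0 ?mulr_ge0.
have intphi n : (\int[mu]_x (phi n x)%:E <= (c / (2 ^ n.+1)%:R)%:E)%E.
  have -> : (\int[mu]_x (phi n x)%:E = (\int[mu]_x phi n x)%:E)%E.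
    by rewrite /Rintegral fineK //;
      exact: (integrable_fin_num measurableT (phiI n)).
  rewrite lee_fin /phi.
  have qI F : L2 mu W F -> mu.-integrable setT
    (EFin \o (fun x => q%:R * density W F x)).
    by move=> /densI; exact: integrableZ_real.
  have sE (s : R) F : L2 mu W F ->
      \int[mu]_x (s * (q%:R * density W F x)) = s * (q%:R * sqnorm mu W F).
    move=> LF; rewrite RintegralZl ?RintegralZl //; last exact: qI.
      by rewrite (sqnormE q0 Wpos Wmeas LF).
    exact: densI.
  have sI (s : R) F : L2 mu W F ->
      mu.-integrable setT (EFin \o (fun x => s * (q%:R * density W F x))).
    by move=> /qI; exact: integrableZ_real.
  rewrite RintegralD //; [|exact: sI|exact: (sI _ _ inv_weight_L2)].
  rewrite (sE _ _ (LPB _ _)) (sE _ _ inv_weight_L2).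
  have := cauchy n n.+1 (leqnSn n); set a := sqnorm _ _ _; set b :=
    sqnorm _ _ _.
  have -> : 4^-1 ^+ n = (2 ^+ n)^-1 ^+ 2 :> R.
    by rewrite -exprVn exprAC; congr (_ ^+ n); rewrite exprVn -natrX.
  have -> : (2 ^ n.+1)%:R = 2 * 2 ^+ n :> R by rewrite natrX exprS.
  rewrite -/a -/b /c; have := tn0 n; move: (2 ^+ n) => t t0 at2.
  have -> : q%:R * (1 + b) *+ 2 / (2 * t) =
    t * (q%:R * t^-1 ^+ 2) + t^-1 * (q%:R * b).
    by rewrite -mulr_natr; field; rewrite gt_eqF.
  by rewrite lerD2r; apply: ler_wpM2l; [exact: ltW|exact: ler_wpM2l].
have [N [mN muN cN]] := summable_ae_cvg c_ge0 mphi phi0 intphi.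
have ccP x : ~ N x -> forall i j,
    exists l : C, ccvg (fun n => P n x i j) l.
  move=> Nx i j; have cx := cN x Nx.
  have inc n : `|P n.+1 x i j - P n x i j| <= (phi n x)%:C%C.
    have := entry_le_density (P n.+1 \- P n) x i j (tn0 n).
    by rewrite [in leLHS]/= [in leLHS]mxE [in leLHS]mxE.
  have cRe : cvgn (fun n => Re (P n x i j)).
    apply: cvg_increments cx => n.
    have -> : Re (P n.+1 x i j) - Re (P n x i j) =
      Re (P n.+1 x i j - P n x i j).
      by case: (P n.+1 x i j); case: (P n x i j).
    exact: Re_le_norm.
  have cIm : cvgn (fun n => Im (P n x i j)).
    apply: cvg_increments cx => n.
    have -> : Im (P n.+1 x i j) - Im (P n x i j) =
      Im (P n.+1 x i j - P n x i j).
      by case: (P n.+1 x i j); case: (P n x i j).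
    exact: Im_le_norm.
  by exists (Complex (limn (fun n => Re (P n x i j)))
    (limn (fun n => Im (P n x i j)))).
have [F0 F0P] : exists F0 : T -> 'I_q -> 'I_q -> C, forall x i j,
    ~ N x -> ccvg (fun n => P n x i j) (F0 x i j).
  have h (p : T * 'I_q * 'I_q) : exists l : C, ~ N p.1.1 ->
      ccvg (fun n => P n p.1.1 p.1.2 p.2) l.
    have [Np|Np] := pselect (N p.1.1); first by exists 0.
    by have [l cl] := ccP _ Np p.1.2 p.2; exists l.
  have [f fP] := choice h.
  by exists (fun x i j => f (x, i, j)) => x i j; exact: (fP (x, i, j)).
(* The limit is cut off on the null set [N], where nothing is known of [F0]. *)
pose chi : T -> C := fun x => (\1_(~` N) x)%:C%C.
have chi1 x : ~ N x -> chi x = 1 by move=> Nx; rewrite /chi indicE mem_set.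
have chi0 x : N x -> chi x = 0 by move=> Nx;
  rewrite /chi indicE memNset // => /(_ Nx).
pose F x : 'M[C]_q := \matrix_(i, j) (chi x * F0 x i j).
have cvF x : ~ N x -> forall i j, ccvg (fun n => P n x i j) (F x i j).
  by move=> Nx i j; rewrite mxE chi1 // mul1r; exact: F0P.
have mchi : cmeasurable chi.
  split; first by apply: measurable_indic; exact: measurableC.
  exact: measurable_cst.
have mF : mxmeasurable F.
  move=> i j.
  have mh n : cmeasurable (fun x => chi x * P n x i j).
    by apply: cmeasurableM => //; case: (LP n).
  have ch x : ccvg (fun n => chi x * P n x i j) (F x i j).
    have [Nx|Nx] := pselect (N x).
      rewrite mxE chi0 // mul0r; under eq_fun do rewrite mul0r; exact: ccvg_cst.
    by rewrite chi1 //; under eq_fun do rewrite mul1r; exact: cvF.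
  split.
    apply: (measurable_fun_cvg (h := fun n x => Re (chi x * P n x i j))).
      by move=> n; case: (mh n).
    by move=> x _; case: (ch x).
  apply: (measurable_fun_cvg (h := fun n x => Im (chi x * P n x i j))).
    by move=> n; case: (mh n).
  by move=> x _; case: (ch x).
have mFB m : mxmeasurable (F \- P m).
  apply: mxmeasurableD => // i j; case: (LP m) => /(_ i j)[mR mI] _.
  split; first by under eq_fun do rewrite mxE raddfN; exact: measurable_funN.
  by under eq_fun do rewrite mxE raddfN; exact: measurable_funN.
have bound m : (\int[mu]_x (density W (F \- P m) x)%:E <= (4^-1 ^+ m)%:E)%E.
  rewrite (ge0_negligible_integral mN measurableT _ _ muN); last 2 first.
  - by apply/measurable_EFinP; exact: measurable_density.
  - by move=> x _; rewrite lee_fin.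
  have mE : measurable (setT `\` N) by exact: measurableD.
  (* Shifting by [m] makes the Cauchy bound hold for all the terms. *)
  pose f n x := (density W (P (n + m)%N \- P m) x)%:E.
  have mf n : measurable_fun setT (f n).
    by apply/measurable_EFinP; apply: measurable_density;
      case: (LPB (n + m)%N m).
  have -> : (\int[mu]_(x in setT `\` N) (density W (F \- P m) x)%:E =
             \int[mu]_(x in setT `\` N) limn_einf (f^~ x))%E.
    apply: eq_integral => x; rewrite inE => -[_ Nx].
    have [cR _] : ccvg (fun n => ntr
      ((P (n + m)%N \- P m) x *m W x *m ((P (n + m)%N \- P m) x)^t*))
                (ntr ((F \- P m) x *m W x *m ((F \- P m) x)^t*)).
      apply: mxccvg_sandwich => i j; rewrite mxE [(- P m x) i j]mxE.
      under eq_fun do rewrite mxE [(- P m x) i j]mxE.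
      by apply: ccvgD; [exact: (@ccvg_shift _ m (fun n => P n x i j) _
        (cvF x Nx i j))|exact: ccvg_cst].
    have cf : f n x @[n --> \oo] --> (density W (F \- P m) x)%:E.
      by apply: cvg_EFin => //; near=> n.
    by have [-> _] := cvg_limn_einf_sup cf.
  have mfE n : measurable_fun (setT `\` N) (f n) by exact: measurable_funTS.
  have f0 n x : (setT `\` N) x -> (0 <= f n x)%E by rewrite lee_fin.
  apply: (le_trans (fatou mu mE mfE f0)).
  apply: limn_einf_le => n.
  apply: (@le_trans _ _ (\int[mu]_x f n x)%E).
    by apply: ge0_subset_integral => // x _; rewrite lee_fin.
  have LB := LPB (n + m)%N m.
  have -> : (\int[mu]_x f n x = (sqnorm mu W (P (n + m)%N \- P m))%:E)%E.
    rewrite (sqnormE q0 Wpos Wmeas LB) /Rintegral fineK //.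
    exact: (integrable_fin_num measurableT (densI _ LB)).
  by rewrite lee_fin; apply: cauchy; exact: leq_addl.
have LFB m : L2 mu W (F \- P m).
  apply/(L2P mu Wpos); split; first exact: mFB.
  apply/integrableP; split; first by apply/measurable_EFinP;
    exact: measurable_density.
  under eq_integral do rewrite gee0_abs ?lee_fin //.
  by apply: le_lt_trans (bound m) _; exact: ltry.
exists F => [|m].
  have -> : F = (fun x => (F \- P 0%N) x + P 0%N x).
    by apply/funext => x /=; rewrite subrK.
  exact: (L2D q0 Wpos Wmeas (LFB _) (LP _)).
rewrite (sqnormE q0 Wpos Wmeas (LFB m)) -lee_fin /Rintegral fineK //.
exact: (integrable_fin_num measurableT (densI _ (LFB m))).
Unshelve. all: by end_near.
Qed.

End completeness.

(** * Orthogonal projection *)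

Section arbitrarily_small.
Context {R : realType}.

Lemma exists_expV4_lt (e : R) : 0 < e -> exists n : nat, 4^-1 ^+ n < e.
Proof.
move=> e0.
have c0 : (4^-1 ^+ n : R) @[n --> \oo] --> 0.
  by apply: cvg_expr; rewrite ger0_norm ?invr_ge0 // invf_lt1 // ltr1n.
have /cvgrPdist_lt/(_ e e0)[n _ nP] := c0.
by exists n; have := nP n (leqnn n); rewrite /= sub0r normrN ger0_norm.
Qed.

(** Let [e] tend to [0], then [t] to infinity. *)
Lemma le0_of_scaled (x K : R) :
  (forall t e, 0 < t -> 0 < e -> x <= t * e + t^-1 * K) -> x <= 0.
Proof.
move=> h; apply/ler_addgt0Pr => e e0; rewrite add0r.
pose t := (`|K| + 1) / (e / 2).
have K0 : 0 < `|K| + 1 by rewrite ltr_wpDl.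
have t0 : 0 < t by rewrite divr_gt0 // divr_gt0.
apply: le_trans (h t (e / 2 / t) t0 _) _; first by rewrite !divr_gt0.
rewrite mulrC divfK ?gt_eqF // [leRHS]splitr lerD2l.
rewrite mulrC ler_pdivrMr // mulrC /t divfK; last by rewrite gt_eqF // divr_gt0.
by rewrite (le_trans (ler_norm _)) // lerDl.
Qed.

Lemma le0_of_scaled_sqr (a b : R) : (forall s, 0 < s -> s * a <= s ^+ 2 * b) ->
  a <= 0.
Proof.
move=> h; apply: (@le0_of_scaled a b) => t e t0 e0.
have := h t^-1; rewrite invr_gt0 => /(_ t0).
rewrite expr2 -mulrA ler_pM2l ?invr_gt0 // => ab.
by apply: le_trans ab _; rewrite ler_wpDl // ltW // mulr_gt0.
Qed.

End arbitrarily_small.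

Section sqnorm_theory.
Context d (T : measurableType d) (R : realType)
  (mu : {measure set T -> \bar R}).
Context (q : nat) (q0 : (0 < q)%N).
Local Notation C := R[i].
Local Notation Re := (@complex.Re R).
Variable W : T -> 'M[C]_q.
Hypothesis hW : invertible_weight mu W.
Implicit Types (F G H X Y : T -> 'M[C]_q) (A B : 'M[C]_q).

Let Wpos x : posdefmx (W x) := hW.1.1 x.
Let Wmeas : mxmeasurable W := mxintegrable_mxmeasurable hW.1.2.
Let LB F G := @L2B _ _ _ mu _ q0 W Wpos Wmeas F G.
Let LD F G := @L2D _ _ _ mu _ q0 W Wpos Wmeas F G.
Let LM A F := @L2_mull _ _ _ mu _ q0 W Wpos Wmeas A F.

Definition reinner F G : R := Re (ntr (inner mu W F G)).

Lemma ntrD A B : ntr (A + B) = ntr A + ntr B :> C.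
Proof. by rewrite /ntr mxtraceD mulrDl. Qed.

Lemma ntrN A : ntr (- A) = - ntr A :> C.
Proof. by rewrite /ntr raddfN mulNr. Qed.

Lemma Re_ntrB A B : Re (ntr (A - B)) = Re (ntr A) - Re (ntr B).
Proof. by rewrite ntrD ntrN; case: (ntr A); case: (ntr B). Qed.

Lemma ntr_adj A : ntr (A^t*) = Num.conj (ntr A) :> C.
Proof.
rewrite /ntr fmorph_div rmorph_nat; congr (_ / _).
by rewrite /mxtrace rmorph_sum; apply: eq_bigr => i _; rewrite !mxE.
Qed.

(** The trace of [A A^*] is the sum of the squared moduli of the entries. *)
Lemma gram_eq0 A : Re (ntr (A *m A^t*)) <= 0 -> A = 0.
Proof.
have trE : \tr (A *m A^t*) = \sum_i \sum_k `|A i k| ^+ 2.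
  apply: eq_bigr => i _; rewrite mxE; apply: eq_bigr => k _.
  by rewrite 2!mxE normCK.
have sq0 i : 0 <= \sum_k `|A i k| ^+ 2 :> C.
  by apply: sumr_ge0 => k _; exact: exprn_ge0.
have tr0 : 0 <= \tr (A *m A^t*) by rewrite trE; exact: sumr_ge0.
have n0 : 0 <= ntr (A *m A^t*) by rewrite /ntr divr_ge0.
rewrite -lecR RRe_real ?ger0_real // => n1.
have : ntr (A *m A^t*) == 0 by rewrite eq_le n1 n0.
rewrite /ntr mulf_eq0 invr_eq0 pnatr_eq0 [(q == 0)%N]gtn_eqF // orbF trE.
rewrite psumr_eq0; last by move=> i _; exact: sq0.
move=> /allP AE; apply/matrixP => i k; rewrite [RHS]mxE.
have := AE i (mem_index_enum i);
  rewrite psumr_eq0 => [/allP/(_ k (mem_index_enum k))|? _].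
  by rewrite /= sqrf_eq0 normr_eq0 => /eqP.
exact: exprn_ge0.
Qed.

Lemma reinnerC F G : L2 mu W F -> L2 mu W G -> reinner F G = reinner G F.
Proof.
move=> LF LG; rewrite /reinner -(inner_adj q0 Wpos Wmeas LF LG).
by rewrite ntr_adj Re_conjC.
Qed.

Lemma sqnormB F G : L2 mu W F -> L2 mu W G ->
  sqnorm mu W (F \- G) = sqnorm mu W F + sqnorm mu W G - 2 * reinner F G.
Proof.
move=> LF LG; have LFG := LB LF LG.
rewrite /sqnorm (innerBl q0 Wpos Wmeas LF LG LFG).
rewrite (innerBr q0 Wpos Wmeas LF LG LF) (innerBr q0 Wpos Wmeas LF LG LG).
have := reinnerC LF LG; rewrite /reinner.
generalize (inner mu W F F) (inner mu W F G) (inner mu W G F) (inner mu W G G).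
by move=> ff fg gf gg; rewrite !Re_ntrB => <-; ring.
Qed.

Lemma sqnormBC F G : L2 mu W F -> L2 mu W G ->
  sqnorm mu W (F \- G) = sqnorm mu W (G \- F).
Proof.
move=> LF LG; rewrite (sqnormB LF LG) (sqnormB LG LF) (reinnerC LF LG).
by generalize (sqnorm mu W F) (sqnorm mu W G) => f g; rewrite [f + g]addrC.
Qed.

Lemma inner_mulll A B F : L2 mu W F ->
  inner mu W (fun x => A *m F x) (fun x => B *m F x) =
    A *m inner mu W F F *m B^t*.
Proof.
move=> LF; rewrite (inner_mull q0 Wpos Wmeas A LF (LM B LF)).
by rewrite (inner_mulr q0 Wpos Wmeas B LF LF) mulmxA.
Qed.

Lemma ntrZ (a : C) A : ntr (a *: A) = a * ntr A :> C.
Proof. by rewrite /ntr mxtraceZ mulrA. Qed.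

Lemma adjmx_real_scalar (s : R) : ((s%:C%C)%:M : 'M[C]_q)^t* = (s%:C%C)%:M.
Proof.
rewrite tr_scalar_mx map_scalar_mx; congr (_%:M); exact: conjc_real.
Qed.

Lemma sqnorm_scale (s : R) F : L2 mu W F ->
  sqnorm mu W (fun x => (s%:C%C)%:M *m F x) = s ^+ 2 * sqnorm mu W F.
Proof.
move=> LF; rewrite /sqnorm (inner_mulll _ _ LF) adjmx_real_scalar.
rewrite mul_scalar_mx mul_mx_scalar !ntrZ.
by case: (ntr _) => a b /=; ring.
Qed.

Lemma reinner_scaler (s : R) F G : L2 mu W F -> L2 mu W G ->
  reinner F (fun x => (s%:C%C)%:M *m G x) = s * reinner F G.
Proof.
move=> LF LG; rewrite /reinner (inner_mulr q0 Wpos Wmeas _ LG LF).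
rewrite adjmx_real_scalar mul_mx_scalar ntrZ.
by case: (ntr _) => a b /=; ring.
Qed.

(** The inner product with a fixed element tends to zero with [sqnorm], by
    [inner_le_sqnorm]. *)
Lemma inner_eq0_of_small F G : L2 mu W F -> L2 mu W G ->
  (forall e, 0 < e -> exists H,
    [/\ L2 mu W H, sqnorm mu W H < e & inner mu W F G = inner mu W H G]) ->
  inner mu W F G = 0.
Proof.
move=> LF LG small; apply/matrixP => i j; rewrite [RHS]mxE.
apply/eqP; rewrite -normr_le0.
pose r := Re `|inner mu W F G i j|.
have rE : `|inner mu W F G i j| = r%:C%C by rewrite RRe_real ?normr_real.
rewrite rE lecE /= eqxx /=;
  apply: (@le0_of_scaled _ _ (2 * (q%:R * sqnorm mu W G))) => t e t0 e0.
have q1 : 0 < 2 * q%:R :> R by rewrite mulr_gt0 ?ltr0n.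
have [H [LH He FH]] := small (e / (2 * q%:R)) (divr_gt0 e0 q1).
have := inner_le_sqnorm q0 Wpos Wmeas i j LH LG t0.
rewrite -FH rE lecR; move: He.
generalize (sqnorm mu W H) (sqnorm mu W G) => h g.
rewrite (ltr_pdivlMr _ _ q1) => he rle.
have := ler_wpM2l (ltW t0) (ltW he); lra.
Qed.

Lemma inner_sqnorm0 F G : L2 mu W F -> L2 mu W G ->
  sqnorm mu W F = 0 -> inner mu W F G = 0.
Proof.
by move=> LF LG F0; apply: inner_eq0_of_small => // e e0; exists F; rewrite F0.
Qed.

Lemma L2norm_lt F (e : R) : L2 mu W F -> 0 < e ->
  (L2norm mu W F < e) = (sqnorm mu W F < e ^+ 2).
Proof.
move=> LF e0; rewrite -(L2norm_sqr q0 Wpos Wmeas LF).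
have n0 : 0 <= L2norm mu W F by rewrite /L2norm sqrtr_ge0.
by rewrite (@ltr_pXn2r _ 2 isT _ _ n0 (ltW e0)).
Qed.

Lemma L2closure_orthogonal (M : set (T -> 'M[C]_q)) G :
  M `<=` L2 mu W -> L2 mu W G -> (forall P, M P -> inner mu W P G = 0) ->
  forall F, L2closure mu W M F -> inner mu W F G = 0.
Proof.
move=> ML2 LG orth F [LF clF]; apply: inner_eq0_of_small => // e e0.
have se0 : 0 < Num.sqrt e by rewrite sqrtr_gt0.
have [P MP FP] := clF _ se0; have LP := ML2 _ MP.
exists (F \- P); split; first exact: LB.
  by rewrite (L2norm_lt (LB LF LP) se0) sqr_sqrtr ?ltW in FP.
by rewrite (innerBl q0 Wpos Wmeas LF LP LG) (orth _ MP) subr0.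
Qed.

(** Left multiplication by a constant is bounded, because [sqnorm] dominates
    the entries of the Gram matrix of a function. *)
Lemma sqnorm_mull_le A : exists2 K : R, 0 < K &
  forall F, L2 mu W F -> sqnorm mu W (fun x => A *m F x) <= K * sqnorm mu W F.
Proof.
pose S := \sum_i \sum_k \sum_l `|A i k| * `|A i l|.
have S0 : 0 <= S by do 3 (apply: sumr_ge0 => ? _); exact: mulr_ge0.
have SE : S = (Re S)%:C%C by rewrite RRe_real ?ger0_real.
have ReS0 : 0 <= Re S by rewrite -(@ler0c R) -SE.
exists (4 * Re S + 1) => [|F LF]; first by rewrite ltr_wpDl // mulr_ge0.
have F0 := sqnorm_ge0 q0 Wpos Wmeas LF.
have FA0 := sqnorm_ge0 q0 Wpos Wmeas (LM A LF).
have E kk l : `|inner mu W F F kk l| <= (4 * (q%:R * sqnorm mu W F))%:C%C.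
  have := inner_le_sqnorm q0 Wpos Wmeas kk l LF LF (@ltr01 R).
  by rewrite invr1 !mul1r; congr (_ <= _%:C%C); ring.
suff : sqnorm mu W (fun x => A *m F x) <= 4 * Re S * sqnorm mu W F.
  move=> h; apply: le_trans h _; move: F0.
  by generalize (sqnorm mu W F) (4 * Re S) => f s f0;
    rewrite mulrDl mul1r lerDl.
have := ntr_sqnorm q0 Wpos Wmeas (LM A LF).
rewrite inner_mulll // => nE.
rewrite -lecR -nE /ntr ler_pdivrMr ?ltr0n //.
have -> : (4 * Re S * sqnorm mu W F)%:C%C * q%:R =
    \sum_i \sum_k \sum_l `|A i k| * `|A i l| *
      (4 * (q%:R * sqnorm mu W F))%:C%C.
  under eq_bigr do under eq_bigr do rewrite -mulr_suml.
  under eq_bigr do rewrite -mulr_suml.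
  rewrite -mulr_suml -/S SE !rmorphM !rmorph_nat /=; ring.
have rtr : \tr (A *m inner mu W F F *m A^t*) \is Num.real.
  have -> : \tr (A *m inner mu W F F *m A^t*) =
    (sqnorm mu W (fun x => A *m F x))%:C%C * q%:R.
    by rewrite -nE /ntr divfK // pnatr_eq0 -lt0n.
  by rewrite realM ?realn // complex_real.
apply: le_trans (real_ler_norm rtr) _.
apply: le_trans (ler_norm_sum _ _ _) _; apply: ler_sum => i _.
rewrite mxE; apply: le_trans (ler_norm_sum _ _ _) _.
rewrite exchange_big /=; apply: ler_sum => l _.
rewrite mxE mulr_suml; apply: le_trans (ler_norm_sum _ _ _) _.
apply: ler_sum => k _; rewrite !normrM mulrAC 2!mxE norm_conjC.
by apply: ler_wpM2l => //; exact: mulr_ge0.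
Qed.

Section projection.
Variable M : set (T -> 'M[C]_q).
Hypothesis ML2 : M `<=` L2 mu W.
Hypothesis M0 : M (cst 0).
Hypothesis MD : forall F G, M F -> M G -> M (fun x => F x + G x).
Hypothesis MM : forall A F, M F -> M (fun x => A *m F x).

Lemma L2closure_mull A F :
  L2closure mu W M F -> L2closure mu W M (fun x => A *m F x).
Proof.
move=> [LF clF]; split; first exact: LM.
move=> e e0; have [K K0 KP] := sqnorm_mull_le A.
have e'0 : 0 < Num.sqrt (e ^+ 2 / K) by rewrite sqrtr_gt0 divr_gt0 ?exprn_gt0.
have [P MP FP] := clF _ e'0; have LP := ML2 MP.
exists (fun x => A *m P x); first exact: MM.
have -> : (fun x => A *m F x) \- (fun x => A *m P x) =
  (fun x => A *m (F \- P) x).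
  by apply/funext => x /=; rewrite mulmxBr.
rewrite (L2norm_lt (LM A (LB LF LP)) e0).
rewrite (L2norm_lt (LB LF LP) e'0) sqr_sqrtr in FP; last first.
  by rewrite ltW // divr_gt0 ?exprn_gt0.
by apply: le_lt_trans (KP _ (LB LF LP)) _; rewrite -ltr_pdivlMl // mulrC.
Qed.

Lemma parallelogram Z P Q : L2 mu W Z -> M P -> M Q ->
  sqnorm mu W (P \- Q) = 2 * sqnorm mu W (Z \- P) + 2 * sqnorm mu W (Z \- Q) -
    4 * sqnorm mu W (Z \- (fun x => ((2^-1)%:C%C)%:M *m (P x + Q x))).
Proof.
move=> LZ MP MQ; have [LP LQ] := (ML2 MP, ML2 MQ).
pose a := Z \- P; pose b := Z \- Q.
have La : L2 mu W a := LB LZ LP.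
have Lb : L2 mu W b := LB LZ LQ.
pose b' : T -> 'M[C]_q := fun x => ((-1 : R)%:C%C)%:M *m b x.
have Lb' : L2 mu W b' := LM _ Lb.
have E1 : P \- Q = b \- a.
  by apply/funext => x; rewrite /a /b /= addrAC opprB addrCA subrr addr0 addrC.
have E2 : Z \- (fun x => ((2^-1)%:C%C)%:M *m (P x + Q x)) =
          (fun x => ((2^-1)%:C%C)%:M *m (a \- b') x).
  apply/funext => x; rewrite /a /b' /b /= !mul_scalar_mx.
  rewrite rmorphN1 scaleN1r opprK.
  have {1}-> : Z x = (2^-1)%:C%C *: (Z x + Z x).
    apply/matrixP => i j; rewrite !mxE; move: (Z x i j) => z.
    by rewrite fmorphV rmorph_nat; field.
  by rewrite -scalerBr opprD addrACA.
rewrite E1 E2 -/a -/b (sqnorm_scale _ (LB La Lb')) (sqnormB Lb La)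
  (sqnormB La Lb').
rewrite (sqnorm_scale _ Lb) (reinner_scaler _ La Lb) (reinnerC La Lb).
generalize (sqnorm mu W a) (sqnorm mu W b) (reinner b a) => a2 b2 ab.
by field.
Qed.

(** A minimizing sequence is Cauchy by the parallelogram identity, and its limit
    is the projection. *)
Lemma projection_exists Z : L2 mu W Z ->
  exists2 F, L2closure mu W M F & forall P, M P -> inner mu W (Z \- F) P = 0.
Proof.
move=> LZ.
pose D : set R := [set sqnorm mu W (Z \- P) | P in M].
have Dinf : has_inf D.
  split; first by exists (sqnorm mu W (Z \- cst 0)); exists (cst 0).
  by exists 0 => _ [P MP <-];
    exact: (sqnorm_ge0 q0 Wpos Wmeas (LB LZ (ML2 MP))).
have infD P : M P -> inf D <= sqnorm mu W (Z \- P).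
  by move=> MP; apply: ge_inf; [case: Dinf|exists P].
pose e n : R := 4^-1 ^+ n.
have exP n : exists P, M P /\ sqnorm mu W (Z \- P) < inf D + e n / 4.
  have e0 : 0 < e n / 4 by rewrite divr_gt0 // exprn_gt0 ?invr_gt0.
  by have [_ [P MP <-] Plt] := inf_adherent e0 Dinf; exists P.
have [P PP] := choice exP.
have MP n : M (P n) by case: (PP n).
have LP n : L2 mu W (P n) := ML2 (MP n).
have Mmid A F G : M F -> M G -> M (fun x => A *m (F x + G x)).
  by move=> MF MG; apply: (MM A (F := fun x => F x + G x)); exact: MD.
have cauchy n k : (n <= k)%N -> sqnorm mu W (P k \- P n) <= e n.
  move=> nk; rewrite (parallelogram LZ (MP k) (MP n)).
  have h1 : inf D <=
      sqnorm mu W (Z \- (fun x => ((2^-1)%:C%C)%:M *m (P k x + P n x))).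
    exact: (infD _ (Mmid _ _ _ (MP k) (MP n))).
  have [_ h2] := PP k; have [_ h3] := PP n.
  have h4 : e k <= e n.
    by apply: ler_wiXn2l => //; rewrite ?invr_ge0 // invf_le1 // ler1n.
  move: h1 h2 h3 h4; clear.
  generalize (sqnorm mu W (Z \- P k)) (sqnorm mu W (Z \- P n)) (inf D) (e k)
    (e n)
    (sqnorm mu W (Z \- (fun x => ((2^-1)%:C%C)%:M *m (P k x + P n x)))).
  move=> *; lra.
have [F LF FP] := L2_complete q0 hW LP cauchy.
exists F.
  split=> // r r0; have [n nP] := exists_expV4_lt (exprn_gt0 2 r0).
  exists (P n) => //; rewrite (L2norm_lt (LB LF (LP n)) r0).
  exact: le_lt_trans (FP n) nP.
have LX : L2 mu W (Z \- F) := LB LZ LF.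
(* Minimality of [Z \- P n] up to [e n / 4] against [Q], the error made by
   replacing [P n] by [F] being absorbed in [sqnorm Q]. *)
have key Q : M Q -> reinner (Z \- F) Q <= sqnorm mu W Q.
  move=> MQ; have LQ := ML2 MQ.
  have Q0 := sqnorm_ge0 q0 Wpos Wmeas LQ.
  apply/ler_addgt0Pr => r r0.
  have [n nP] := exists_expV4_lt r0.
  have LPF : L2 mu W (F \- P n) := LB LF (LP n).
  have LZP : L2 mu W (Z \- P n) := LB LZ (LP n).
  have MPQ : M (fun x => P n x + Q x) by exact: MD.
  have h1 := infD _ MPQ; have [_ h2] := PP n.
  have e1 : Z \- (fun x => P n x + Q x) = (Z \- P n) \- Q.
    by apply/funext => x /=; rewrite opprD addrA.
  rewrite e1 (sqnormB LZP LQ) in h1.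
  have h3 := sqnorm_ge0 q0 Wpos Wmeas (LB LPF (LM (((-1 : R)%:C%C)%:M) LQ)).
  have e2 : reinner (Z \- F) Q = reinner (Z \- P n) Q - reinner (F \- P n) Q.
    rewrite /reinner (innerBl q0 Wpos Wmeas LZ LF LQ).
    rewrite (innerBl q0 Wpos Wmeas LZ (LP n) LQ)
      (innerBl q0 Wpos Wmeas LF (LP n) LQ).
    generalize (inner mu W Z Q) (inner mu W F Q) (inner mu W (P n) Q).
    by move=> z f p; rewrite !Re_ntrB; ring.
  have h4 : sqnorm mu W (F \- P n) <= e n := FP n.
  have h5 : e n < r := nP.
  rewrite (sqnormB LPF (LM _ LQ)) (reinner_scaler _ LPF LQ) (sqnorm_scale _ LQ)
    in h3.
  rewrite e2; move: h1 h2 h3 h4 h5 r0; clear.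
  generalize (sqnorm mu W Q) (sqnorm mu W (Z \- P n)) (sqnorm mu W (F \- P n))
    (inf D) (e n) (reinner (Z \- P n) Q) (reinner (F \- P n) Q).
  move=> *; lra.
move=> Q MQ; have LQ := ML2 MQ.
pose E := inner mu W (Z \- F) Q.
(* The left side of [key] is linear in [Q] and the right side quadratic. *)
have le0 B : reinner (Z \- F) (fun x => B *m Q x) <= 0.
  have MBQ := MM B MQ; have LBQ := ML2 MBQ.
  apply: (@le0_of_scaled_sqr _ _ (sqnorm mu W (fun x => B *m Q x))) => s s0.
  rewrite -(sqnorm_scale _ LBQ) -(reinner_scaler _ LX LBQ).
  by apply: key; apply: (MM _ MBQ).
(* For [B := E] the real inner product is the squared norm of [E]. *)
have := le0 E; rewrite /reinner (inner_mulr q0 Wpos Wmeas _ LQ LX) -/E.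
exact: gram_eq0.
Qed.

End projection.

End sqnorm_theory.

(** * Duality for submodules of mean zero *)

Section duality.
Context d (T : measurableType d) (R : realType)
  (mu : {measure set T -> \bar R}).
Context (q : nat) (q0 : (0 < q)%N).
Local Notation C := R[i].
Local Notation Re := (@complex.Re R).
Variable W : T -> 'M[C]_q.
Hypothesis hW : invertible_weight mu W.
Implicit Types (F G H X Y : T -> 'M[C]_q) (A B : 'M[C]_q).

Let Wpos x : posdefmx (W x) := hW.1.1 x.
Let Wmeas : mxmeasurable W := mxintegrable_mxmeasurable hW.1.2.
Let LB F G := @L2B _ _ _ mu _ q0 W Wpos Wmeas F G.
Let LD F G := @L2D _ _ _ mu _ q0 W Wpos Wmeas F G.
Let LM A F := @L2_mull _ _ _ mu _ q0 W Wpos Wmeas A F.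
Let LV : L2 mu W (inv_weight W) := inv_weight_L2 hW.
Let VI : mxmeasurable (inv_weight W) := mxintegrable_mxmeasurable hW.2.

(** The projection of [X] on the multiples of [Y] is [A Y], whose squared norm
    is [c] times the normalized trace of [A A^*]. *)
Lemma sqnorm_ge_unimodular X Y (c : R) A :
  L2 mu W X -> L2 mu W Y -> 0 <= c -> \det A = 1 ->
  inner mu W Y Y = (c%:C%C)%:M -> inner mu W X Y = c%:C%C *: A ->
  c <= sqnorm mu W X.
Proof.
move=> LX LY c0 detA YY XY.
have := sqnorm_ge0 q0 Wpos Wmeas (LB LX (LM A LY)).
rewrite (sqnormB q0 hW LX (LM A LY)) /sqnorm (inner_mulll q0 hW A A LY) YY.
rewrite /reinner (inner_mulr q0 Wpos Wmeas A LY LX) XY.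
rewrite mul_mx_scalar -scalemxAl ntrZ -/(sqnorm mu W X).
have tr1 : 1 <= Re (ntr (A *m A^t*)).
  have := trace_AGM detA.
  rewrite -[X in X <= _]mul1r -ler_pdivlMr ?ltr0n // -/(ntr _).
  by rewrite lecE => /andP[].
have -> : Re (c%:C%C * ntr (A *m A^t*)) = c * Re (ntr (A *m A^t*)).
  by case: (ntr _) => a b /=; ring.
have := ler_wpM2l c0 tr1; lra.
Qed.

(** The maps [G |-> G W^-1] and [H |-> H W] are inverse isometries between
    [L2 (inv_weight W)] and [L2 W];
      the next lemmas say so, and that the integral
    pairing becomes the inner product of [L2 W]. *)
Lemma mul_weight_L2 H : L2 mu W H ->
  L2 mu (inv_weight W) (fun x => H x *m W x).
Proof.
move=> LH; have [mH iH] := LH; split; first exact: mxmeasurableM.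
suff -> : (fun x => ntr (H x *m W x *m inv_weight W x *m (H x *m W x)^t*)) =
          (fun x => ntr (H x *m W x *m (H x)^t*)) by [].
apply/funext => x; rewrite mulmxK ?posdef_unit //.
by rewrite adjmxM (posdef_adj (Wpos x)) mulmxA.
Qed.

Lemma mul_inv_weight_sandwich G x :
  G x *m inv_weight W x *m W x *m (G x *m inv_weight W x)^t* =
  G x *m inv_weight W x *m (G x)^t*.
Proof.
by rewrite mulmxKV ?posdef_unit // adjmxM (inv_weight_adj hW) mulmxA.
Qed.

Lemma mul_inv_weight_L2 G : L2 mu (inv_weight W) G ->
  L2 mu W (fun x => G x *m inv_weight W x).
Proof.
move=> [mG iG]; split; first exact: mxmeasurableM.
by under eq_fun do rewrite mul_inv_weight_sandwich.
Qed.

Lemma L2norm_inv_weight G : L2 mu (inv_weight W) G ->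
  L2norm mu (inv_weight W) G ^+ 2 =
  sqnorm mu W (fun x => G x *m inv_weight W x).
Proof.
move=> LG.
have E : inner mu W (fun x => G x *m inv_weight W x)
  (fun x => G x *m inv_weight W x)
   = inner mu (inv_weight W) G G.
  by rewrite /inner; under eq_fun do rewrite mul_inv_weight_sandwich.
have := sqnorm_ge0 q0 Wpos Wmeas (mul_inv_weight_L2 LG).
by rewrite /L2norm /sqnorm E => h; rewrite sqr_sqrtr.
Qed.

Lemma mxintegral_pairing F G :
  mxintegral mu (fun x => F x *m (G x)^t*) =
  inner mu W F (fun x => G x *m inv_weight W x).
Proof.
rewrite /inner; congr mxintegral; apply/funext => x.
by rewrite adjmxM mulmxA (mulmx_weightK hW).
Qed.

Lemma mxintegral_cst A : mu setT = 1%E -> mxintegral mu (cst A) = A.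
Proof.
move=> mu1; apply/matrixP => i j; rewrite mxE; apply: complex_ext => /=;
  by rewrite Rintegral_cst // mu1 /= mulr1.
Qed.

Lemma inf_unimodular_attained (V : T -> 'M[C]_q) (N : set (T -> 'M[C]_q))
    (c : R) A F :
  \det A = 1 -> N F -> L2norm mu V (cst A \- F) ^+ 2 = c ->
  (forall B G, \det B = 1 -> N G -> c <= L2norm mu V (cst B \- G) ^+ 2) ->
  inf_unimodular mu V N = c%:E.
Proof.
move=> detA NF <- cle; apply/eqP; rewrite eq_le; apply/andP; split.
  by apply: ereal_inf_lbound; exists (A, F).
apply: le_ereal_inf_tmp => _ [[B G] [detB NG] <-]; rewrite lee_fin; exact: cle.
Qed.

Lemma ntr_scalar (a : C) : ntr (a%:M : 'M[C]_q) = a.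
Proof.
by rewrite /ntr mxtrace_scalar -[X in X / _]mulr_natr mulfK // pnatr_eq0 -lt0n.
Qed.

Section mean_zero_submodule.
Hypothesis mu1 : mu setT = 1%E.
Variable M : set (T -> 'M[C]_q).
Hypothesis ML2 : M `<=` L2 mu W.
Hypothesis M0 : M (cst 0).
Hypothesis MD : forall F G, M F -> M G -> M (fun x => F x + G x).
Hypothesis MM : forall A F, M F -> M (fun x => A *m F x).
Hypothesis Mmean : forall P, M P -> mxintegral mu P = 0.

(* The role of the polynomials with frequencies in [S] and [0]. *)
Let Mc : set (T -> 'M[C]_q) :=
  [set F | exists A P, M P /\ F = (fun x => A + P x)].

Section residual.
Variable X : T -> 'M[C]_q.
Hypothesis X1 : L2closure mu W M (cst 1%:M \- X).
Hypothesis LX : L2 mu W X.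
Hypothesis Xorth : forall P, M P -> inner mu W X P = 0.

Let D := inner mu W X X.

Lemma residual_orth F : L2closure mu W M F -> inner mu W F X = 0.
Proof.
apply: (L2closure_orthogonal q0 hW ML2 LX) => P MP.
by rewrite -(inner_adj q0 Wpos Wmeas LX (ML2 MP)) (Xorth MP) adjmx0.
Qed.

(** Elements of [M] have mean zero, and the mean is continuous on [L2 W]: so
    [X] has the mean of [1]. *)
Lemma residual_integral : mxintegral mu X = 1%:M.
Proof.
have L1 := cst_L2 hW 1%:M; have L1X : L2 mu W (cst 1%:M \- X) := LB L1 LX.
have : inner mu W (cst 1%:M \- X) (inv_weight W) = 0.
  apply: (L2closure_orthogonal q0 hW ML2 LV) X1 => P MP.
  by rewrite (inner_inv_weight hW) Mmean.
rewrite (innerBl q0 Wpos Wmeas L1 LX LV) !(inner_inv_weight hW).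
by rewrite (mxintegral_cst _ mu1) => /eqP; rewrite subr_eq0 => /eqP.
Qed.

Lemma inner_cst_residual A : inner mu W (cst A) X = A *m D.
Proof.
have L1 := cst_L2 hW 1%:M; have L1X : L2 mu W (cst 1%:M \- X) := LB L1 LX.
have D1 : inner mu W (cst 1%:M) X = D.
  have := residual_orth X1; rewrite (innerBl q0 Wpos Wmeas L1 LX LX) => /eqP.
  by rewrite subr_eq0 => /eqP.
have e : (fun x : T => A *m (cst 1%:M : T -> 'M[C]_q) x) = cst A.
  by apply/funext => x; exact: mulmx1.
by have := inner_mull q0 Wpos Wmeas A L1 LX; rewrite e D1.
Qed.

(** If [v D v^*] were zero, the function all of whose rows are [v X] would have
    norm zero, hence mean zero; but its mean has all its rows equal to [v]. *)
Lemma gram_residual_posdef : posdefmx D.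
Proof.
split; first by apply: adj_hermsymmx;
  rewrite /D (inner_adj q0 Wpos Wmeas LX LX).
move=> v v0; pose B : 'M[C]_q := \matrix_(i, j) v 0 j.
have rowB i : row i B = v by apply/rowP => j; rewrite !mxE.
have BD i : (B *m D *m B^t*) i i = (v *m D *m v^t*) 0 0.
  by rewrite sandwichE rowB.
have LBX := LM B LX.
have nE : (v *m D *m v^t*) 0 0 = (sqnorm mu W (fun x => B *m X x))%:C%C.
  rewrite -(ntr_sqnorm q0 Wpos Wmeas LBX) (inner_mulll q0 hW B B LX) -/D.
  rewrite /ntr /mxtrace (eq_bigr _ (fun i _ => BD i)) sumr_const card_ord.
  by rewrite -[X in X / _]mulr_natr mulfK // pnatr_eq0 -lt0n.
rewrite nE ltcE /= eqxx /= lt0r (sqnorm_ge0 q0 Wpos Wmeas LBX) andbT.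
apply: contraNneq v0 => s0.
have := inner_sqnorm0 q0 hW LBX LV s0.
rewrite (inner_mull q0 Wpos Wmeas B LX LV) (inner_inv_weight hW).
rewrite residual_integral mulmx1 => B0.
by rewrite -(rowB (Ordinal q0)) B0; apply/eqP/rowP => j; rewrite !mxE.
Qed.

End residual.

Lemma residual_closure X :
  L2closure mu W M (cst 1%:M \- X) -> L2 mu W X -> L2closure mu W Mc X.
Proof.
move=> [LF clF] LX; split=> [|e e0]; first exact: LX.
have [P MP FP] := clF e e0; have LP := ML2 MP.
have L1 := cst_L2 hW 1%:M.
pose Q : T -> 'M[C]_q := fun x => 1%:M + (- 1%:M) *m P x.
exists Q; first by exists 1%:M, (fun x => (- 1%:M) *m P x); split=> //;
  exact: MM.
have L1P : L2 mu W ((cst 1%:M \- X) \- P) := LB LF LP.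
have LXQ : L2 mu W (X \- Q) := LB LX (LD L1 (LM _ LP)).
rewrite (L2norm_lt q0 hW L1P e0) in FP; rewrite (L2norm_lt q0 hW LXQ e0).
have E : X \- Q = P \- (cst 1%:M \- X).
  apply/funext => x; rewrite /Q /=.
  by rewrite mulNmx mul1mx !opprB addrCA.
by rewrite E (sqnormBC q0 hW LP LF).
Qed.

(** The minimum of both problems is reached along the residual [X] of the
    projection of the constant [1] on the closure of [M]: by the multiples
    [A X] on one side and, after the isometry [G |-> G W^-1] onto [L2 W], by
    the multiples [B D^-1 X] on the other, [D] being the Gram matrix of [X]. *)
Lemma unimodular_duality :
  inf_unimodular mu W (L2closure mu W M) =
  ((inf_unimodular mu (inv_weight W) (L2dual mu W (L2closure mu W Mc)))^-1)%E.
Proof.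
have L1 := cst_L2 hW 1%:M.
have [F0 clF0 orth0] := projection_exists q0 hW ML2 M0 MD MM L1.
have [LF0 _] := clF0.
pose X := cst 1%:M \- F0.
have LX : L2 mu W X := LB L1 LF0.
have X1 : L2closure mu W M (cst 1%:M \- X).
  have -> // : cst 1%:M \- X = F0.
  by apply/funext => x; rewrite /X /= opprB addrC subrK.
pose D := inner mu W X X.
have Dpos : posdefmx D := gram_residual_posdef X1 LX.
have Dunit := posdef_unit Dpos; have DE := posdef_adj Dpos.
have [A [c [detA c0 AD]]] := posdef_unimodular_congr q0 Dpos.
have Aunit : A \in unitmx by rewrite unitmxE detA unitr1.
have cn0 : c%:C%C != 0 :> C by rewrite eq_complex /= eqxx andbT gt_eqF.
have DA : D *m A^t* = c%:C%C *: invmx A.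
  by rewrite -[LHS](mulKmx Aunit) (mulmxA A) AD mul_mx_scalar.
have LAX := LM A LX.
have AX : inner mu W (fun x => A *m X x) (fun x => A *m X x) = (c%:C%C)%:M.
  by rewrite (inner_mulll q0 hW A A LX).
have sAX : sqnorm mu W (fun x => A *m X x) = c.
  by rewrite /sqnorm AX ntr_scalar.
have primal : inf_unimodular mu W (L2closure mu W M) = c%:E.
  have clAF : L2closure mu W M (fun x => A *m F0 x).
    exact: (L2closure_mull q0 hW ML2 MM A clF0).
  apply: (inf_unimodular_attained detA clAF).
  - have -> : cst A \- (fun x => A *m F0 x) = (fun x => A *m X x).
      by apply/funext => x; rewrite /X /= mulmxBr mulmx1.
    by rewrite (L2norm_sqr q0 Wpos Wmeas LAX).
  - move=> B G detB clG; have [LG _] := clG; have LcB := cst_L2 hW B.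
    have LBG : L2 mu W (cst B \- G) := LB LcB LG.
    rewrite (L2norm_sqr q0 Wpos Wmeas LBG).
    apply: (sqnorm_ge_unimodular (A := B *m invmx A) LBG LAX (ltW c0) _ AX).
      by rewrite det_mulmx det_inv detB detA invr1 mulr1.
    rewrite (inner_mulr q0 Wpos Wmeas A LX LBG)
      (innerBl q0 Wpos Wmeas LcB LG LX).
    rewrite (residual_orth LX orth0 clG) subr0 (inner_cst_residual X1 LX orth0).
    by rewrite -mulmxA DA -scalemxAr.
(* [E] is [B0 D^-1] for the [B0] below, as [A D A^* = c 1]; thus [Y] is the
   projection of [B0 W^-1]. *)
pose E : 'M[C]_q := (c^-1)%:C%C *: A.
have cV : (c^-1)%:C%C = (c%:C%C)^-1 :> C by rewrite fmorphV.
have EE : E^t* = (c^-1)%:C%C *: A^t*.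
  rewrite /E adjmxZ; congr (_ *: _); exact: conjc_real.
have DEt : D *m E^t* = invmx A.
  by rewrite EE -scalemxAr DA scalerA cV mulVf // scale1r.
pose Y : T -> 'M[C]_q := fun x => E *m X x.
have LY : L2 mu W Y := LM E LX.
have YY : inner mu W Y Y = ((c^-1)%:C%C)%:M.
  rewrite (inner_mulll q0 hW E E LX) -mulmxA DEt /E -scalemxAl mulmxV //.
  by rewrite scale_scalar_mx mulr1.
pose B0 := invmx (A^t*).
have B0E : B0^t* = invmx A by rewrite /B0 adjmxV trmxCK.
pose H : T -> 'M[C]_q := (fun x => B0 *m inv_weight W x) \- Y.
have LBV := LM B0 LV.
have LH : L2 mu W H := LB LBV LY.
pose G : T -> 'M[C]_q := fun x => H x *m W x.
have LG : L2 mu (inv_weight W) G := mul_weight_L2 LH.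
have GV : (fun x => G x *m inv_weight W x) = H.
  by apply/funext => x; rewrite /G mulmxK // posdef_unit.
have McL2 : Mc `<=` L2 mu W.
  by move=> _ [A' [P [MP ->]]]; exact: (LD (cst_L2 hW A') (ML2 MP)).
have dG : L2dual mu W (L2closure mu W Mc) G.
  split=> [|F clF]; first exact: LG.
  rewrite mxintegral_pairing GV.
  apply: (L2closure_orthogonal q0 hW McL2 LH) clF => _ [A' [P [MP ->]]].
  have LA' := cst_L2 hW A'; have LP := ML2 MP.
  have LAP : L2 mu W (fun x => A' + P x) := LD LA' LP.
  rewrite (innerBr q0 Wpos Wmeas LBV LY LAP).
  rewrite (inner_mulr q0 Wpos Wmeas B0 LV LAP)
    (inner_mulr q0 Wpos Wmeas E LX LAP).
  rewrite (innerDl q0 Wpos Wmeas LA' LP LV) (innerDl q0 Wpos Wmeas LA' LP LX).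
  rewrite !(inner_inv_weight hW) (Mmean MP) (mxintegral_cst _ mu1).
  rewrite (inner_cst_residual X1 LX orth0) -(inner_adj q0 Wpos Wmeas LX LP).
  rewrite (orth0 _ MP) adjmx0 !addr0 B0E -mulmxA.
  by rewrite -/D DEt subrr.
have dual : inf_unimodular mu (inv_weight W)
    (L2dual mu W (L2closure mu W Mc)) = (c^-1)%:E.
  have detB0 : \det B0 = 1 by rewrite det_inv det_adjmx detA rmorph1 invr1.
  apply: (inf_unimodular_attained detB0 dG).
    have BG : cst B0 \- G = (fun x => Y x *m W x).
      apply/funext => x; rewrite /G /H /= mulmxBl mulmxKV ?posdef_unit //.
      by rewrite opprB addrC subrK.
    have LYW := mul_weight_L2 LY.
    rewrite BG (L2norm_inv_weight LYW).
    have -> : (fun x => Y x *m W x *m inv_weight W x) = Y.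
      by apply/funext => x; rewrite mulmxK // posdef_unit.
    by rewrite /sqnorm YY ntr_scalar.
  move=> B G' detB [LG' dG'].
  have LcB : L2 mu (inv_weight W) (cst B).
    have -> : cst B = (fun x => B *m inv_weight W x *m W x).
      by apply/funext => x; rewrite mulmxKV // posdef_unit.
    exact: (mul_weight_L2 (LM B LV)).
  have LBG : L2 mu (inv_weight W) (cst B \- G').
    exact: (@L2B _ _ _ mu _ q0 _ (fun x => posdef_inv (Wpos x)) VI _ _ LcB LG').
  have LG'V := mul_inv_weight_L2 LG'.
  have LK := mul_inv_weight_L2 LBG.
  rewrite (L2norm_inv_weight LBG).
  have c1 : 0 <= c^-1 by rewrite invr_ge0 ltW.
  apply: (sqnorm_ge_unimodular (A := B *m A^t*) LK LY c1 _ YY).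
    by rewrite det_mulmx det_adjmx detA detB rmorph1 mulr1.
  have KE : (fun x => (cst B \- G') x *m inv_weight W x) =
      (fun x => B *m inv_weight W x) \- (fun x => G' x *m inv_weight W x).
    by apply/funext => x; rewrite /= mulmxBl.
  rewrite KE (inner_mulr q0 Wpos Wmeas E LX (LB (LM B LV) LG'V)).
  rewrite (innerBl q0 Wpos Wmeas (LM B LV) LG'V LX).
  rewrite (inner_mull q0 Wpos Wmeas B LV LX).
  rewrite -(inner_adj q0 Wpos Wmeas LX LV) -(inner_adj q0 Wpos Wmeas LX LG'V).
  rewrite -mxintegral_pairing (dG' _ (residual_closure X1 LX)) adjmx0 subr0.
  by rewrite (inner_inv_weight hW) (residual_integral X1 LX) adjmx1 mulmx1 EE
    scalemxAr.
by rewrite primal dual inver gt_eqF ?invr_gt0 // invrK.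
Qed.

End mean_zero_submodule.

End duality.

(** * Trigonometric polynomials *)

Section trigonometric_polynomials.
Context {R : realType} {G : zmodType} {q : nat}.
Local Notation C := R[i].
Local Notation dual := (dual_group R G).
Local Notation TB := (dual_borel R G).
Implicit Types (S : set G) (F : TB -> 'M[C]_q) (s : seq (G * 'M[C]_q)).

(** Lists of pairs of a frequency and a coefficient can be concatenated, which
    makes closure under sums immediate. *)
Definition trig_sum s : TB -> 'M[C]_q :=
  fun x => \sum_(p <- s) (x : dual) p.1 *: p.2.

(** Coefficients attached to a repeated frequency add up. *)
Lemma trig_polyP S F : trig_poly S F <->
  exists s, (forall p, p \in s -> S p.1) /\ F = trig_sum s.
Proof.
split=> [[s [A [sS ->]]]|[s [sS ->]]].
  exists [seq (g, A g) | g <- s]; split; first by move=> _ /mapP[g /sS Sg ->].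
  by apply/funext => x; rewrite /trig_sum big_map.
exists (undup [seq p.1 | p <- s]), (fun g => \sum_(p <- s | p.1 == g) p.2);
  split.
  by move=> g; rewrite mem_undup => /mapP[p /sS Sp ->].
apply/funext => x; rewrite /trig_sum.
under [RHS]eq_bigr do rewrite scaler_sumr big_mkcond.
rewrite exchange_big /= big_seq [RHS]big_seq; apply: eq_bigr => p ps.
have up : p.1 \in undup [seq r.1 | r <- s] by rewrite mem_undup map_f.
rewrite (bigD1_seq p.1 up (undup_uniq _)) /= eqxx big1 ?addr0 // => g gp.
by rewrite eq_sym (negPf gp).
Qed.

Lemma trig_poly0 S : trig_poly S (cst 0 : TB -> 'M[C]_q).
Proof.
by apply/trig_polyP; exists [::]; split=> //; apply/funext => x;
  rewrite /trig_sum big_nil.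
Qed.

Lemma trig_polyD S F H : trig_poly S F -> trig_poly S H ->
  trig_poly S (fun x => F x + H x).
Proof.
move=> /trig_polyP[s [sS ->]] /trig_polyP[t [tS ->]]; apply/trig_polyP.
exists (s ++ t); split; first by move=> p; rewrite mem_cat => /orP[/sS|/tS].
by apply/funext => x; rewrite /trig_sum big_cat.
Qed.

Lemma trig_poly_mull S A F : trig_poly S F -> trig_poly S (fun x => A *m F x).
Proof.
move=> /trig_polyP[s [sS ->]]; apply/trig_polyP.
exists [seq (p.1, A *m p.2) | p <- s]; split.
  by move=> _ /mapP[p /sS Sp ->].
apply/funext => x; rewrite /trig_sum big_map mulmx_sumr.
by apply: eq_bigr => p _; rewrite scalemxAr.
Qed.

Lemma dual_fun0 (x : dual) : x 0 = 1.
Proof.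
have := dual_funD x 0 0; rewrite addr0 => /esym/eqP.
rewrite -[X in _ == X]mulr1 (inj_eq (mulfI (dual_fun_neq0 x 0))) => /eqP //.
Qed.

(** The terms of frequency [0] add up to the constant. *)
Lemma trig_poly_setU0 S :
  trig_poly (S `|` [set 0]) = [set F : TB -> 'M[C]_q |
    exists A P, trig_poly S P /\ F = (fun x => A + P x)].
Proof.
apply/seteqP; split=> F.
  move=> /trig_polyP[s [sS ->]].
  exists (\sum_(p <- s | p.1 == 0) p.2), (trig_sum [seq p <- s | p.1 != 0]);
    split.
    apply/trig_polyP; exists [seq p <- s | p.1 != 0]; split=> // p.
    by rewrite mem_filter => /andP[p0 /sS[//|/= p0']]; rewrite p0' eqxx in p0.
  apply/funext => x; rewrite /trig_sum big_filter (bigID (fun p => p.1 == 0))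
    /=.
  congr (_ + _); apply: eq_bigr => p /eqP ->; by rewrite dual_fun0 scale1r.
move=> [A [P [/trig_polyP[s [sS ->]] ->]]]; apply/trig_polyP.
exists ((0, A) :: s); split.
  by move=> p; rewrite inE => /orP[/eqP ->|/sS]; [right|left].
by apply/funext => x; rewrite /trig_sum big_cons dual_fun0 scale1r.
Qed.

Section integral.
Variable lambda : probability TB R.
Hypothesis hlambda : haar_measure lambda.

Lemma monomial_mxmeasurable g (A : 'M[C]_q) :
  mxmeasurable (fun x : TB => (x : dual) g *: A).
Proof.
move=> i j; under eq_fun do rewrite mxE.
by apply: cmeasurableM; [exact: char_cmeasurable|exact: cmeasurable_cst].
Qed.

Lemma trig_poly_mean S F : ~ S 0 -> trig_poly S F -> mxintegral lambda F = 0.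
Proof.
move=> S0 /trig_polyP[s [sS ->]]; apply/matrixP => i j; rewrite !mxE.
have -> : (fun x : TB => trig_sum s x i j) =
    (fun x : TB => \sum_(p <- s) p.2 i j * (x : dual) p.1).
  apply/funext => x; rewrite /trig_sum summxE.
  by apply: eq_bigr => p _; rewrite mxE mulrC.
suff [] : cintegrable lambda
  (fun x : TB => \sum_(p <- s) p.2 i j * (x : dual) p.1) /\
  cintegral lambda (fun x : TB => \sum_(p <- s) p.2 i j * (x : dual) p.1) =
    0 by [].
elim: s sS => [|p s IHs] sS.
  under eq_fun do rewrite big_nil.
  by split; [exact: cintegrable0|exact: cintegral0].
have p0 : p.1 != 0.
  by apply/eqP => p0; apply: S0; rewrite -p0; apply: sS; rewrite mem_head.
have [ip ip0] := haar_char_integral hlambda p0.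
have [is0 is1] : _ := IHs (fun r rs => sS r (mem_behead (s := p :: s) rs)).
under eq_fun do rewrite big_cons; split.
  by apply: cintegrableD => //; exact: cintegrableZ.
rewrite cintegralD //; last exact: cintegrableZ.
by rewrite cintegralZ // ip0 mulr0 is1 add0r.
Qed.

Lemma trig_poly_L2 (q0 : (0 < q)%N) (W : TB -> 'M[C]_q) S :
  weight lambda W -> trig_poly S `<=` L2 lambda W.
Proof.
move=> [Wpos iW] F /trig_polyP[s [_ ->]].
have mW := mxintegrable_mxmeasurable iW.
elim: s => [|p s IHs].
  have -> : trig_sum [::] = (fun=> 0).
    by apply/funext => x; rewrite /trig_sum big_nil.
  apply: L2_of_sandwich; first exact: mxmeasurable_cst.
  under eq_fun do rewrite !mul0mx.
  by move=> i j; under eq_fun do rewrite mxE; exact: cintegrable0.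
have -> : trig_sum (p :: s) = (fun x => (x : dual) p.1 *: p.2 + trig_sum s x).
  by apply/funext => x; rewrite /trig_sum big_cons.
apply: (L2D q0 Wpos mW) IHs.
apply: L2_of_sandwich; first exact: monomial_mxmeasurable.
have -> : (fun x : TB => (x : dual) p.1 *: p.2 *m W x *m
  ((x : dual) p.1 *: p.2)^t*) =
          (fun x => p.2 *m W x *m p.2^t*).
  apply/funext => x; rewrite adjmxZ -!scalemxAl -scalemxAr scalerA -normCK.
  by rewrite dual_fun_norm1 expr1n scale1r.
exact: (mxintegrable_mulr _ (mxintegrable_mull _ iW)).
Qed.

End integral.

End trigonometric_polynomials.

Theorem theorem3p6 (R : realType) (G : zmodType)
    (lambda : probability (dual_borel R G) R) (hlambda : haar_measure lambda)
    (q : nat) (hq : (0 < q)%N)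
    (W : dual_borel R G -> 'M[R[i]]_q) (hW : invertible_weight lambda W)
    (S : set G) (hS : ~ S 0) :
  delta lambda W S =
    ((inf_unimodular lambda (inv_weight W)
        (L2dual lambda W (trig_closure lambda W (S `|` [set 0%R]))))^-1)%E.
Proof.
rewrite /delta /trig_closure trig_poly_setU0.
apply: (unimodular_duality hq hW (probability_setT lambda)).
- exact: (trig_poly_L2 hq hW.1).
- exact: trig_poly0.
- by move=> F H; exact: trig_polyD.
- by move=> A F; exact: trig_poly_mull.
- by move=> P; exact: trig_poly_mean.
Qed.
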